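(* There is a universal constant $c_{\mathrm{bdg}}>0$ such that the following holds. Assume $\mathcal I\ne\emptyset$, the localized Slater condition (LSCQ) with constants $\eta_*,\vartheta_*$, and that $x\mapsto F_i(x,\xi)$ is convex on $Y$ for all $i\in\mathcal I_0$, $\xi\in\Xi$. Assume $(\sigma_*^2,\sigma^2,\alpha,\rho)$-goodness over $Z=X_{\eta_*}^{*,\vartheta_*}$. Suppose that the constant $\vartheta_*$ of the localized Slater condition (LSCQ) satisfies $\vartheta_*>0$ and that, for some $\mathfrak c>0$ and $\kappa\in(0,1]$, $\mathrm{diam}(X^{*,\epsilon})\le\mathfrak c\,\epsilon^\kappa+\mathrm{diam}(X^* )$ for all $\epsilon\in(0,\vartheta_*]$. Assume $0<\alpha\kappa<1$. Let $t>0$ and $0\le\epsilon_0<\min\{\vartheta_*/4,1/2\}$. Then there is a constant $\mathfrak C>1$ depending only on $\eta_*,\vartheta_*,\sigma,\sigma_*,\alpha,\kappa,\mathfrak c$ and $\mathrm{diam}(X^* )$ for which the following holds. Let $\phi_N(t):=\sqrt{(\mathfrak C_\alpha+\log|\mathcal I|+t)/N}$ and assume $N$ is large enough that $\mathfrak C\,\phi_N(t)\le1$. Let $$\mathfrak R_N:=\max\{2\epsilon_0,\ \mathfrak C\,\phi_N^\alpha(t)\},\qquad \mathfrak D_N:=\mathfrak C\,\phi_N(t)+\mathfrak C\,\phi_N(t)\max\{\epsilon_0^{\alpha\kappa},\ \phi_N^{\alpha^2\kappa}(t)\}.$$ Let $\mathrm{Good}(t,\epsilon_0)$ be the event where all of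 the following hold: (a) $\widehat X^{*,\epsilon_0}\subset X_{\mathfrak D_N}^{*,\mathfrak R_N}$, i.e. all $x\in\widehat X$ with $\widehat F(x)\le\widehat F^*+\epsilon_0$ satisfy $f(x)\le f^*+\mathfrak R_N$ and $\max_{i\in\mathcal I}f_i(x)\le\mathfrak D_N$; (b) $|\widehat F^*-f^*|\le\sigma_*\sqrt{\dfrac{6(1+\log(2|\mathcal I|+2)+t)}{N}}+\dfrac{\mathfrak R_N}{2}+\max\{\mathfrak R_N,\mathrm{gap}(\mathfrak D_N)\}$; (c) for all $x\in\widehat X^{*,\epsilon_0}$, $\mathrm{dist}(x,X)\le\min\left\{\dfrac{\mathrm{diam}(X^{*,\vartheta_*})\,\mathfrak D_N}{\eta_*},\ 2\,\mathrm{diam}(X^{*,\mathfrak R_N})\right\}$. Then $\mathbb P(\mathrm{Good}(t,\epsilon_0))\ge1-e^{-t}-2(|\mathcal I|+1)\rho$. If one assumes $(\sigma_*^2,\sigma^2,\alpha,p,\kappa_p)$-greatness over $Y$ instead of $(\sigma_*^2,\sigma^2,\alpha,\rho)$-goodness, one may take $\rho=(c_{\mathrm{bdg}}\,\kappa_p\sqrt{p/N})^p$.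
   Context: Setting. $\|\cdot\|$ is a norm on $\mathbb R^d$; $\mathrm{diam}$ and $\mathrm{dist}(x,A)=\inf_{a\in A}\|x-a\|$ are taken in this norm. $\mathcal I$ is a finite index set, $0\notin\mathcal I$, $\mathcal I_0=\mathcal I\cup\{0\}$. $(\Xi,\sigma(\Xi),\mathbf P)$ is a probability space and $\xi_1,\dots,\xi_N$ are i.i.d. with law $\mathbf P$, defined on $(\Omega,\mathcal A,\mathbb P)$. For a function $H$ on $\Xi$, $\mathbf E H=\int H\,d\mathbf P$ and $\widehat{\mathbf E}H=\frac1N\sum_{k=1}^N H(\xi_k)$. $Y\subset\mathbb R^d$, and for $i\in\mathcal I_0$, $F_i:Y\times\Xi\to\mathbb R$ is Carathéodory (measurable in $\xi$, continuous in $x$) with $\mathbf E|F_i(x,\cdot)|<\infty$ for all $x\in Y$; $f_i(x):=\mathbf E F_i(x,\cdot)$, $\widehat F_i(x):=\widehat{\mathbf E}F_i(x,\cdot)$, $f:=f_0$, $\widehat F:=\widehat F_0$. Ideal problem: for $\delta\in\mathbb R$, $X_\delta:=\{x\in Y: f_i(x)\le\delta\ \forall i\in\mathcal I\}$, $X:=X_0\neq\emptyset$. $f^*:=\min_X f$ is assumed attained, and $x^*\in X$ is a fixed minimizer. $f^*_\delta:=\inf_{X_\delta}f$, $\mathrm{gap}(\delta):=|f^*_\delta-f^*|$ (when $X_\delta\neq\emptyset$). $X_\delta^{*,\vartheta}:=\{x\in X_\delta: f(x)\le f^*+\vartheta\}$, $X^{*,\vartheta}:=X_0^{*,\vartheta}$,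 $X^*:=X^{*,0}$. Sample average approximation (SAA): $\widehat X:=\{x\in Y:\widehat F_i(x)\le0\ \forall i\in\mathcal I\}$, $\widehat F^*:=\min_{\widehat X}\widehat F$ (the SAA is assumed always to have a solution), $\widehat X^{*,\vartheta}:=\{x\in\widehat X:\widehat F(x)\le\widehat F^*+\vartheta\}$. Localized Slater condition (LSCQ) with constants $\eta_*,\vartheta_*$: $Y$ is convex and closed, the $f_i$ ($i\in\mathcal I_0$) are continuous and convex, $\eta_*>0$, $X^{*,\vartheta_*}$ is bounded and $X_{-\eta_*}^{*,\vartheta_*}\ne\emptyset$. $h:\Xi\to\mathbb R_+$ is $(\sigma^2,\rho)$-good if $\mathbf E h\le\sigma^2$ and $\mathbb P\{\widehat{\mathbf E}h>2\sigma^2\}\le\rho$; for $p\ge2$ it is $(\sigma^2,p,\kappa_p)$-great if $\mathbf E h\le\sigma^2$ and $\|h(\xi)-\mathbf E h\|_{L^p}\le\kappa_p\sigma^2$ for $\xi\sim\mathbf P$. $(\sigma_*^2,\sigma^2,\alpha,\rho)$-goodness over $Z\subset Y$ with $x^*\in Z$ (where $\sigma^2,\sigma_*^2,\rho>0$, $\alpha\in(0,1]$) means: the $f_i$ and $F_i(\cdot,\xi)$, $i\in\mathcal I_0$, are continuous on $Y$; for each $i\in\mathcal I_0$ the function $\xi\mapsto(F_i(x^*,\xi)-f_i(x^* ))^2$ is $(\sigma_*^2,\rho)$-good; and for each $i\in\mathcal I_0$ there is $\mathsf L_i:\Xi\to\mathbb R$ such that $\mathsf L_i^2$ is $(\sigma^2,\rho)$-good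 and $|F_i(x,\xi)-F_i(x',\xi)|\le\mathsf L_i(\xi)\|x-x'\|^\alpha$ for all $x,x'\in Z$, $\xi\in\Xi$. $(\sigma_*^2,\sigma^2,\alpha,p,\kappa_p)$-greatness over $Z$ (with $p\ge2$, $\kappa_p\ge1$) is the same with ''$(\sigma_*^2,\rho)$-good'', ''$(\sigma^2,\rho)$-good'' replaced by ''$(\sigma_*^2,p,\kappa_p)$-great'', ''$(\sigma^2,p,\kappa_p)$-great''. Generic chaining functional: for a metric space $\mathcal M$, a sequence $\{\mathcal A_j\}_{j\ge0}$ of partitions is admissible if $|\mathcal A_0|=1$, $|\mathcal A_j|\le2^{2^j}$ for $j\ge1$; $\mathrm{diam}(\mathcal A_j)$ is the largest diameter of a cell; $\gamma_2^{(\alpha)}(\mathcal M):=\inf_{\text{admissible}}\sum_{j\ge0}2^{j/2}\mathrm{diam}(\mathcal A_j)^\alpha$ (metric from $\|\cdot\|$). Finally $$\mathfrak C_\alpha:=\sup_{\epsilon\in[0,\vartheta_*]}\left(\frac{\gamma_2^{(\alpha)}(X^{*,\epsilon})}{\mathrm{diam}^\alpha(X^{*,\epsilon})}\right)^2,$$ with the convention that the ratio is $1$ when $X^{*,\epsilon}$ is a single point. *)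

(* Defs.v *)
From HB Require Import structures.
From mathcomp Require Import all_boot all_order all_algebra.
From mathcomp Require Import all_classical all_reals all_analysis.

Set Implicit Arguments.
Unset Strict Implicit.
Unset Printing Implicit Defensive.

Import Order.TTheory GRing.Theory Num.Theory.
Import numFieldNormedType.Exports.

Local Open Scope classical_set_scope.
Local Open Scope ring_scope.

(* The finite index set is a finType [I]; I_0 = I u {0} is [option I], with
   [None] for the index 0.  R^d is ['rV[R]_d]; its library topology is the
   usual one, induced by every norm on R^d, so it is the topology used for
   "closed" and "continuous".  The given norm is a function [nrm]. *)

Section Norm.
Context {R : realType} {d : nat}.
Implicit Types (nrm : 'rV[R]_d -> R) (A : set 'rV[R]_d).

Definition is_norm nrm : Prop :=
  [/\ forall x y, nrm (x + y) <= nrm x + nrm y,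
      forall a x, nrm (a *: x) = `|a| * nrm x
    & forall x, nrm x = 0 -> x = 0].

Definition norm_bounded nrm A : Prop := exists M : R, forall x, A x -> nrm x <= M.

(* The element 0 only matters for A empty, where it gives diam A = 0. *)
Definition diam nrm A : \bar R :=
  ereal_sup (0%E |` [set (nrm (x - y))%:E | x in A & y in A]).

Definition dist nrm (x : 'rV[R]_d) A : \bar R :=
  ereal_inf [set (nrm (x - a))%:E | a in A].

End Norm.

Section Chaining.
Context {R : realType} {d : nat} (nrm : 'rV[R]_d -> R).
Implicit Types (M : set 'rV[R]_d) (AA : set (set 'rV[R]_d)).

Definition diam_partition AA : \bar R := ereal_sup [set diam nrm A | A in AA].

(* No nestedness of successive partitions is required. *)
Definition admissible M (AA : nat -> set (set 'rV[R]_d)) : Prop :=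
  [/\ forall j, partition (AA j) id M,
      (AA 0%N #= `I_1)%card
    & forall j, (1 <= j)%N -> (AA j #<= `I_(2 ^ (2 ^ j))%N)%card].

Definition gamma2 (alpha : R) M : \bar R :=
  ereal_inf
    [set (\sum_(0 <= j <oo)
            (2 `^ (j%:R / 2))%:E * diam_partition (AA j) `^ alpha)%E
      | AA in admissible M].

Definition chaining_ratio (alpha : R) M : \bar R :=
  if `[< exists x, M = [set x] >] then 1%E
  else (gamma2 alpha M / (diam nrm M `^ alpha))%E.

End Chaining.

(* Constrained problems min {g_0(x) : x in Y, g_i(x) <= delta for i in I};
   used with g = f (ideal problem) and with g = the sample averages (SAA). *)
Section Program.
Context {R : realType} {d : nat} {I : finType}.
Implicit Types (nrm : 'rV[R]_d -> R) (Y : set 'rV[R]_d).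
Implicit Types (g : option I -> 'rV[R]_d -> R).

Definition feasible Y g (delta : R) : set 'rV[R]_d :=
  [set x | Y x /\ forall i : I, g (Some i) x <= delta].

Definition minimizer Y g (x : 'rV[R]_d) : Prop :=
  feasible Y g 0 x /\ forall y, feasible Y g 0 y -> g None x <= g None y.

Definition optval Y g : R := inf (g None @` feasible Y g 0).

Definition optval_relaxed Y g (delta : R) : \bar R :=
  ereal_inf [set (g None x)%:E | x in feasible Y g delta].

Definition gap Y g (delta : R) : \bar R :=
  `| optval_relaxed Y g delta - (optval Y g)%:E |%E.

(* The optimality level is always relative to the value at delta = 0. *)
Definition near_opt Y g (delta theta : R) : set 'rV[R]_d :=
  [set x | feasible Y g delta x /\ g None x <= optval Y g + theta].

Definition localized_slater nrm Y g (eta theta : R) : Prop :=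
  [/\ convex_set Y /\ closed Y,
      forall i, {within Y, continuous (g i)} /\ convex_function Y (g i),
      0 < eta,
      norm_bounded nrm (near_opt Y g 0 theta)
    & near_opt Y g (- eta) theta !=set0].

Definition chaining_const nrm Y g (alpha theta : R) : \bar R :=
  ereal_sup [set (chaining_ratio nrm alpha (near_opt Y g 0 eps) ^+ 2)%E
            | eps in `[0, theta]%classic].

End Program.

Section Stochastic.
Context {R : realType} {d : nat} {I : finType}.
Context {dXi dOmega : measure_display}.
Context {Xi : measurableType dXi} {Omega : measurableType dOmega}.
Context (P : probability Xi R) (PP : probability Omega R).
Context (N : nat) (xi : 'I_N -> Omega -> Xi).
Implicit Types (Y Z : set 'rV[R]_d) (F : option I -> 'rV[R]_d -> Xi -> R).
Implicit Types (h : Xi -> R).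

Definition iid_sample : Prop :=
  [/\ forall k, measurable_fun setT (xi k),
      forall k A, measurable A -> PP (xi k @^-1` A) = P A
    & forall (J : {set 'I_N}) (A : 'I_N -> set Xi),
        (forall k, measurable (A k)) ->
        PP (\bigcap_(k in [set` J]) (xi k @^-1` A k)) =
        (\prod_(k in J) PP (xi k @^-1` A k))%E].

Definition emp_mean h (w : Omega) : R := N%:R^-1 * \sum_(k < N) h (xi k w).

Definition mean_fun F (i : option I) (x : 'rV[R]_d) : R :=
  \int[P]_s F i x s.

Definition saa_fun F (w : Omega) (i : option I) (x : 'rV[R]_d) : R :=
  emp_mean (F i x) w.

Definition caratheodory Y F : Prop :=
  [/\ forall i x, Y x -> measurable_fun setT (F i x),
      forall i s, {within Y, continuous (fun x => F i x s)}
    & forall i x, Y x -> P.-integrable setT (EFin \o F i x)].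

Definition good (rho s2 : R) h : Prop :=
  [/\ forall s, 0 <= h s, measurable_fun setT h,
      ('E_P[h] <= s2%:E)%E
    & (PP [set w | (2 * s2 < emp_mean h w)%R] <= rho%:E)%E].

Definition great (p kappap s2 : R) h : Prop :=
  [/\ forall s, 0 <= h s, measurable_fun setT h,
      ('E_P[h] <= s2%:E)%E
    & (Lnorm P p%:E (fun s => (h s - fine 'E_P[h])%:E) <= (kappap * s2)%:E)%E].

(* Common shape of goodness and greatness: [Q s2 h] is the requirement
   "h is (s2, ..)-good" resp. "h is (s2, ..)-great". *)
Definition regular_over (Q : R -> (Xi -> R) -> Prop) (nrm : 'rV[R]_d -> R)
    Y F (xstar : 'rV[R]_d) Z (s2star s2 alpha : R) : Prop :=
  [/\ [/\ Z `<=` Y, Z xstar, 0 < s2star, 0 < s2 & 0 < alpha <= 1],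
      forall i, {within Y, continuous (mean_fun F i)}
                /\ forall s, {within Y, continuous (fun x => F i x s)},
      forall i, Q s2star (fun s => (F i xstar s - mean_fun F i xstar) ^+ 2)
    & forall i, exists L : Xi -> R,
        Q s2 (fun s => L s ^+ 2) /\
        forall x x' s, Z x -> Z x' ->
          `|F i x s - F i x' s| <= L s * nrm (x - x') `^ alpha].

Definition goodness nrm Y F xstar Z (s2star s2 alpha rho : R) : Prop :=
  0 < rho /\ regular_over (good rho) nrm Y F xstar Z s2star s2 alpha.

Definition greatness nrm Y F xstar Z (s2star s2 alpha p kappap : R) : Prop :=
  [/\ 2 <= p, 1 <= kappap
    & regular_over (great p kappap) nrm Y F xstar Z s2star s2 alpha].

(* "E has probability at least r", for an event E described by a property
   that is not known to be measurable: E contains a measurable event of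
   probability at least r.  For measurable E this is r <= PP E. *)
Definition prob_ge (E : set Omega) (r : R) : Prop :=
  exists A, [/\ measurable A, A `<=` E & (r%:E <= PP A)%E].

End Stochastic.

Section Rates.
Context {R : realType} {I : finType}.

(* Extended-real valued because [Calpha] is a supremum in \bar R. *)
Definition phi_rate (Calpha : \bar R) (t : R) (N : nat) : \bar R :=
  sqrte ((Calpha + (ln #|I|%:R + t)%:E) * (N%:R^-1)%:E)%E.

Definition R_rate (C alpha eps0 phi : R) : R :=
  Num.max (2 * eps0) (C * phi `^ alpha).

Definition D_rate (C alpha kappa eps0 phi : R) : R :=
  C * phi + C * phi *
    Num.max (eps0 `^ (alpha * kappa)) (phi `^ (alpha ^+ 2 * kappa)).

End Rates.
Arguments phi_rate {R} I Calpha t N.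

(* Here [f] is the family of expectations, [Fhat w] the family of sample
   averages, and [RN], [DN] the two rates. *)
Definition good_event {R : realType} {d : nat} {I : finType} {Omega : Type}
    (nrm : 'rV[R]_d -> R) (Y : set 'rV[R]_d)
    (f : option I -> 'rV[R]_d -> R)
    (Fhat : Omega -> option I -> 'rV[R]_d -> R)
    (eta theta sigmastar eps0 t : R) (N : nat) (RN DN : R) : set Omega :=
  [set w |
    [/\ near_opt Y (Fhat w) 0 eps0 `<=` near_opt Y f DN RN,
        (`|optval Y (Fhat w) - optval Y f|%:E <=
          (sigmastar *
             Num.sqrt (6 * (1 + ln (2 * #|I|%:R + 2) + t) / N%:R))%:E
          + (RN / 2)%:E + maxe RN%:E (gap Y f DN))%E
      & forall x, near_opt Y (Fhat w) 0 eps0 x ->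
        (dist nrm x (feasible Y f 0) <=
          mine (diam nrm (near_opt Y f 0 theta) * (DN / eta)%:E)
               (2%:E * diam nrm (near_opt Y f 0 RN)))%E]].

(* Main.v *)
Require Import Defs.
From HB Require Import structures.
From mathcomp Require Import all_boot all_order all_algebra.
From mathcomp Require Import all_classical all_reals all_analysis.
From mathcomp Require Import measurable_realfun.
From mathcomp Require Import ring lra.
Import Order.TTheory GRing.Theory Num.Theory.
Import numFieldNormedType.Exports.
Local Open Scope classical_set_scope.
Local Open Scope ring_scope.

(** Put Z0 = X^{*,theta} and V = X_{eta/2}^{*,theta}.  Averaging with the
    midpoint x' of x^* and a Slater point maps V into Z0 and exactly halves
    distances, so the admissible partitions of Z0 give nets of V at the same
    cost.  On V, generic chaining bounds |Fhat_i - f_i| by K phi.  The increments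
    are heavy tailed, but exp(x - x^2) <= 1 + x + x^2 gives a self-normalized
    exponential inequality whose random normalization is controlled by the
    empirical mean of L_i^2, i.e. by goodness; only countably many points enter,
    hence measurability of the event.

    Convexity does the rest.  Let x be epsilon_0-optimal for the sample problem.
    On the segment from x' to x, a point of V satisfies the constraints defining
    V with a fixed margin, because Fhat_i is convex and close to f_i on V; hence
    the segment cannot leave V and x itself lies in V.  There the deviation bound
    gives (a) and (b), and moving x towards a Slater point gives (c).  This
    already works with K phi in place of DN: the max in DN only enlarges it.

    Greatness implies goodness by a Fuk-Nagaev truncation argument. *)

(** * Sample solutions under a uniform deviation bound *)

(** The hypotheses live on different sets. The Hoelder moduli are available up to constraint level
    eta, but the chaining constant and the diameters describe sets of constraint level 0, while a
    sample solution may violate the constraints: a deviation bound on Z0 alone would not reach it.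
    The level eta/2 of V is what averaging can repay: x' has constraint values at most -eta/2, so
    its midpoint with a point of V is feasible, and the excess objective there is at most (theta/2 +
    theta)/2. C has to be fixed before the dimension, the norm and the law. It sees the geometry
    only through a bound D on the diameter of Z0, which comes from the growth hypothesis at theta;
    the complexity of Z0 is left to phi. Each index may fail with probability 2 rho + 3 exp(-u): rho
    for the moduli, rho for the fluctuation at [xstar], the rest for the tails. With u = t + ln|I| +
    3 the tails of all |I| + 1 indices together cost at most exp(-t). *)

Lemma divr_itv01 {R : realFieldType} (a b : R) :
  0 <= a -> 0 < b -> a <= b -> 0 <= a / b <= 1.
Proof.
by move=> a0 b0 ab; rewrite divr_ge0 ?(ltW b0)//= ler_pdivrMr// mul1r.
Qed.

Lemma convex_set_segment {R : realType} (M : lmodType R) (Y : set M) (x y : M) (a : R) :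
  convex_set Y -> 0 <= a <= 1 -> Y x -> Y y -> Y (a *: x + (1 - a) *: y).
Proof.
move=> cY /andP[a0 a1] /mem_set Yx /mem_set Yy.
by have := cY x y (Itv01 a0 a1) Yx Yy; rewrite inE.
Qed.

Lemma convex_function_segment {R : realType} (M : lmodType R) (Y : set M)
    (g : M -> R) (x y : M) (a : R) :
  convex_function Y g -> 0 <= a <= 1 -> Y x -> Y y ->
  g (a *: x + (1 - a) *: y) <= a * g x + (1 - a) * g y.
Proof.
by move=> cg /andP[a0 a1] /mem_set Yx /mem_set Yy; exact: (cg (Itv01 a0 a1)).
Qed.

(** Continuity is only relative to [Y], so [x] is approached along points of a segment that are
    required to lie in [Y]. *)
Lemma within_continuous_le {R : realType} d (Y : set 'rV[R]_d)
    (g : 'rV[R]_d -> R) (x y : 'rV[R]_d) (s : nat -> R) (b : R) :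
  {within Y, continuous g} -> s n @[n --> \oo] --> (0 : R) ->
  (forall n, Y (s n *: y + (1 - s n) *: x)) -> Y x ->
  (forall n, g (s n *: y + (1 - s n) *: x) <= b) -> g x <= b.
Proof.
move=> cg s0 Ys Yx gb.
have xs : (s n *: y + (1 - s n) *: x) @[n --> \oo] --> x.
  have -> : nbhs x = nbhs (0 *: y + (1 - 0) *: x).
    by rewrite scale0r subr0 scale1r add0r.
  apply: cvgD; apply: cvgZr_tmp => //.
  by apply: cvgB => //; exact: cvg_cst.
have gx : g (s n *: y + (1 - s n) *: x) @[n --> \oo] --> g x.
  have /subspace_continuousP/(_ x Yx) gY := cg.
  apply: cvg_trans gY => A /= /xs[n _ nA]; exists n => // m /nA /=.
  exact.
by apply: (cvgr_to_le gx); exact: nearW.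
Qed.

Lemma minimizer_optval {R : realType} {d} {I : finType} (Y : set 'rV[R]_d)
    (g : option I -> 'rV[R]_d -> R) (x : 'rV[R]_d) :
  minimizer Y g x -> optval Y g = g None x.
Proof.
move=> [fx mx]; apply/le_anti/andP; split.
  by apply: ge_inf; [exists (g None x) => _ [y fy <-]; exact: mx|exists x].
by apply: lb_le_inf; [exists (g None x), x|move=> _ [y fy <-]; exact: mx].
Qed.

Lemma near_optS {R : realType} {d} {I : finType} (Y : set 'rV[R]_d)
    (g : option I -> 'rV[R]_d -> R) (a b s t : R) :
  a <= b -> s <= t -> near_opt Y g a s `<=` near_opt Y g b t.
Proof.
move=> ab st x [[Yx gx] gs]; split; first split=> // i.
  exact: le_trans (gx i) ab.
by apply: le_trans gs _; rewrite lerD2l.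
Qed.

Lemma diam_ge {R : realType} {d} (nrm : 'rV[R]_d -> R) (A : set 'rV[R]_d) x y :
  A x -> A y -> ((nrm (x - y))%:E <= diam nrm A)%E.
Proof. by move=> Ax Ay; apply: ereal_sup_ubound; right; exists x => //; exists y. Qed.

Lemma diam_ge0 {R : realType} {d} (nrm : 'rV[R]_d -> R) (A : set 'rV[R]_d) :
  (0 <= diam nrm A)%E.
Proof. by apply: ereal_sup_ubound; left. Qed.

Section Norm.
Context {R : realType} {d : nat} (nrm : 'rV[R]_d -> R).
Hypothesis nrm_norm : is_norm nrm.

Lemma is_norm_ge0 x : 0 <= nrm x.
Proof.
have [tri hom _] := nrm_norm.
have := tri x (-1 *: x); rewrite hom normrN1 mul1r scaleN1r subrr.
have -> : nrm 0 = 0 by rewrite -(scale0r 0) hom normr0 mul0r.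
by move=> ?; lra.
Qed.

Lemma is_norm0 : nrm 0 = 0.
Proof. by have [_ hom _] := nrm_norm; rewrite -(scale0r 0) hom normr0 mul0r. Qed.

Lemma is_normB x y : nrm (x - y) = nrm (y - x).
Proof.
by have [_ hom _] := nrm_norm; rewrite -opprB -scaleN1r hom normrN1 mul1r.
Qed.

End Norm.

Section Deterministic.
Context {R : realType} {d : nat} {I : finType} (nrm : 'rV[R]_d -> R).
Variables (Y : set 'rV[R]_d) (f fh : option I -> 'rV[R]_d -> R).
Variables (xstar xbar xhat : 'rV[R]_d) (eta theta e eps0 : R).
Hypothesis nrm_norm : is_norm nrm.
Hypothesis convexY : convex_set Y.
Hypothesis continuousf : forall i, {within Y, continuous (f i)}.
Hypothesis convexf : forall i, convex_function Y (f i).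
Hypothesis convexfh : forall i, convex_function Y (fh i).
Hypotheses (eta_gt0 : 0 < eta) (theta_gt0 : 0 < theta).
Hypothesis xstarP : minimizer Y f xstar.
Hypothesis xhatP : minimizer Y fh xhat.
Hypothesis xbarP : near_opt Y f (- eta) theta xbar.
Hypotheses (e_gt0 : 0 < e) (e_eta : e <= eta / 4).
Hypothesis e_theta : e * (2 + theta / eta) <= theta / 4.
Hypothesis eps0P : 0 <= eps0 < theta / 4.
Hypothesis dev : forall i x, near_opt Y f (eta / 2) theta x ->
  `|fh i x - f i x| <= e.

(* [lra] ignores hypotheses that are section variables. *)
Local Ltac slra := move: eta_gt0 theta_gt0 e_gt0 e_eta e_theta eps0P; lra.

Let mix (a : R) := a *: xbar + (1 - a) *: xstar.

(** Moving from [xstar] towards the Slater point buys slack [a * eta] at the objective price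
    [a * theta]. The exchange rate [theta / eta] in the later bounds comes from here. *)
Lemma slater_mix (a : R) : 0 <= a <= 1 -> near_opt Y f (- (a * eta)) (a * theta) (mix a).
Proof.
move=> a01; have [[Yb fb]] := xbarP; have [[Ys fs] _] := xstarP.
rewrite /near_opt /= (minimizer_optval _ _ _ xstarP) => ob.
have /andP[a0 a1] := a01.
split; first split; first exact: convex_set_segment.
  move=> i; apply: (le_trans (convex_function_segment _ _ _ _ _ _ (convexf _) a01 Yb Ys)).
  have := ler_wpM2l a0 (fb i).
  have a1' : 0 <= 1 - a by slra.
  have := ler_wpM2l a1' (fs i).
  by slra.
apply: (le_trans (convex_function_segment _ _ _ _ _ _ (convexf _) a01 Yb Ys)).
have := ler_wpM2l a0 ob.
by slra.
Qed.

Lemma slater_mix_near (a : R) : 0 <= a <= 1 -> near_opt Y f (eta / 2) theta (mix a).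
Proof.
move=> a01; apply: near_optS (slater_mix a a01).
  have /andP[a0 a1] := a01; have := mulr_ge0 a0 (ltW eta_gt0). slra.
have /andP[a0 a1] := a01.
by rewrite -[leRHS]mul1r ler_wpM2r// ltW.
Qed.

(** The competitor is the point of the segment whose slack is exactly [e]: it stays feasible for the
    sample problem, and it pays [e * theta / eta] for the slack and [e] for the deviation of the
    objective. *)
Lemma optval_saa_le : optval Y fh <= optval Y f + e * (1 + theta / eta).
Proof.
have a01 : 0 <= e / eta <= 1.
  by apply: divr_itv01; slra.
have [[Ym fm] om] := slater_mix _ a01.
have dm i := dev i _ (slater_mix_near _ a01).
rewrite (minimizer_optval _ _ _ xhatP).
have fhm : feasible Y fh 0 (mix (e / eta)).
  split=> // i; have := dm (Some i); have := fm i.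
  by rewrite divfK ?gt_eqF// ler_norml => ? /andP[]; slra.
have [_ /(_ _ fhm)] := xhatP.
have := dm None; rewrite ler_norml => /andP[_].
have -> : e * (1 + theta / eta) = e + e / eta * theta by field; rewrite gt_eqF.
move: om; slra.
Qed.

(** Nothing is known yet about [f] at [x]. Convexity of [fh] carries the sample values at both ends
    to [y], and only there, where [y] is assumed to be in the tube, are they turned into values of
    [f]. By [e_eta] and [e_theta] the result leaves margins of at least [eta / 4] and [theta / 4]
    inside the tube. *)
Lemma saa_near_opt_step x y : near_opt Y fh 0 eps0 x -> near_opt Y f (eta / 2) theta y ->
  (exists2 a, 0 <= a <= 1 & y = a *: mix (1 / 2) + (1 - a) *: x) ->
  (forall i, f (Some i) y <= e) /\
  f None y <= optval Y f + theta / 2 + e * (2 + theta / eta).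
Proof.
move=> [[Yx fx] ox] Vy [a a01 ya].
have h01 : 0 <= (1 / 2 : R) <= 1 by slra.
have [[Ym fm] om] := slater_mix _ h01.
have dm i := dev i _ (slater_mix_near _ h01).
have dy i := dev i _ Vy.
have /andP[a0 a1] := a01.
have a1' : 0 <= 1 - a by slra.
have fhy i : fh i y <= a * fh i (mix (1 / 2)) + (1 - a) * fh i x.
  by rewrite ya; exact: convex_function_segment.
split=> [i|].
  have := fhy (Some i); have := dy (Some i); have := dm (Some i).
  rewrite !ler_norml => /andP[_ u1] /andP[u2 _] u3.
  have u4 : fh (Some i) (mix (1 / 2)) <= 0 by move: (fm i); slra.
  have := ler_wpM2l a0 u4; have := ler_wpM2l a1' (fx i); slra.
have := fhy None; have := dy None; have := dm None.
rewrite !ler_norml => /andP[_ u1] /andP[u2 _] u3.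
have u4 : fh None (mix (1 / 2)) <= optval Y f + theta / 2 + e * (1 + theta / eta).
  have : 0 <= e * (theta / eta) by rewrite mulr_ge0 ?divr_ge0 ?ltW.
  by move: om; slra.
have u5 : fh None x <= optval Y f + theta / 2 + e * (1 + theta / eta).
  by move: ox optval_saa_le eps0P => /= ? ? /andP[]; slra.
have := ler_wpM2l a0 u4; have := ler_wpM2l a1' u5; slra.
Qed.

(* Along the segment from [mix (1/2)] to [x] the points of the tube are interior
   to it by a fixed margin, so it can be followed by steps that close a fixed
   fraction [tau] of the remaining distance to [x]. *)
Lemma saa_near_opt_sub : near_opt Y fh 0 eps0 `<=` near_opt Y f (eta / 2) theta.
Proof.
move=> x xP; have [[Yx fx] ox] := xP.
have h01 : 0 <= (1 / 2 : R) <= 1 by slra.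
have [[Ym _] _] := slater_mix _ h01.
(* The sums replace maxima over the finitely many indices. [M] may depend on [x], since it only sets
   the step length. *)
pose M := 1 + \sum_i `|f i x - optval Y f| + \sum_i `|f i x|.
have M1 i : f i x <= M.
  have s1 : 0 <= \sum_i `|f i x - optval Y f| by exact: sumr_ge0.
  apply: (le_trans (ler_norm _)).
  rewrite /M (bigD1 i (F := fun i => `|f i x|))//=.
  have : 0 <= \sum_(j | j != i) `|f j x| by exact: sumr_ge0.
  by slra.
have M2 i : f i x - optval Y f <= M.
  have s1 : 0 <= \sum_i `|f i x| by exact: sumr_ge0.
  apply: (le_trans (ler_norm _)).
  rewrite /M (bigD1 i (F := fun i => `|f i x - optval Y f|))//=.
  have : 0 <= \sum_(j | j != i) `|f j x - optval Y f| by exact: sumr_ge0.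
  by slra.
have M_gt0 : 1 <= M by rewrite /M -addrA lerDl addr_ge0// sumr_ge0.
pose m := Num.min eta theta.
have m_gt0 : 0 < m by rewrite lt_min eta_gt0.
have [me mt] : m <= eta /\ m <= theta by rewrite !ge_min !lexx orbT.
(* One step adds at most [tau * M <= m / 4] to each value, which fits into both margins; the summand
   [m] in the denominator keeps [tau] below 1. *)
pose tau := m / (4 * (M + m)).
have M4 : 0 < 4 * (M + m) by slra.
have tau_gt0 : 0 < tau by rewrite divr_gt0.
have tau_M : tau * M <= m / 4.
  by rewrite /tau mulrAC ler_pdivrMr//; nra.
have tau1 : tau < 1 by rewrite ltr_pdivrMr// mul1r; slra.
pose y (n : nat) := (1 - tau) ^+ n *: mix (1 / 2) + (1 - (1 - tau) ^+ n) *: x.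
have s01 n : 0 <= (1 - tau) ^+ n <= 1.
  by rewrite exprn_ge0 ?exprn_ile1//; slra.
have yV n : near_opt Y f (eta / 2) theta (y n).
  elim: n => [|n IH].
    by rewrite /y expr0 scale1r subrr scale0r addr0; exact: slater_mix_near.
  have [yi y0] : (forall i, f (Some i) (y n) <= e) /\
      f None (y n) <= optval Y f + theta / 2 + e * (2 + theta / eta).
    apply: (saa_near_opt_step x) => //.
    by exists ((1 - tau) ^+ n).
  have yS : y n.+1 = (1 - tau) *: y n + (1 - (1 - tau)) *: x.
    rewrite /y exprS [in RHS]scalerDr !scalerA -[RHS]addrA -[in RHS]scalerDl.
    congr (_ + _ *: _).
    by ring.
  have t01 : 0 <= 1 - tau <= 1 by slra.
  have [[Yy _] _] := IH.
  have fy i : f i (y n.+1) <= (1 - tau) * f i (y n) + (1 - (1 - tau)) * f i x.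
    by rewrite yS; exact: convex_function_segment.
  have fM (b : R) : b <= M -> tau * b <= m / 4.
    by move=> bM; apply: le_trans tau_M; rewrite ler_pM2l.
  split; first split.
  - by rewrite yS; exact: convex_set_segment.
  - move=> i; apply: (le_trans (fy _)).
    have := fM _ (M1 (Some i)); have t0 : 0 <= 1 - tau by slra.
    have := ler_wpM2l t0 (yi i); have := mulr_ge0 (ltW tau_gt0) (ltW e_gt0).
    by slra.
  - apply: (le_trans (fy _)).
    have := fM _ (M2 None); have t0 : 0 <= 1 - tau by slra.
    have := ler_wpM2l t0 y0.
    set b := e * (2 + theta / eta).
    have b0 : 0 <= b by rewrite mulr_ge0 ?addr_ge0 ?divr_ge0 ?ltW.
    have := mulr_ge0 (ltW tau_gt0) b0.
    have := mulr_ge0 (ltW tau_gt0) (ltW theta_gt0).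
    by move: e_theta; rewrite -/b; lra.
have s0 : (1 - tau) ^+ n @[n --> \oo] --> (0 : R).
  by apply: cvg_expr; rewrite ger0_norm; slra.
have Yy n : Y (y n) by have [[]] := yV n.
split; first split=> // i.
  by apply: (within_continuous_le _ _ _ _ (mix (1 / 2)) _ _ (continuousf _) s0) => // n;
    have [[_]] := yV n; exact.
by apply: (within_continuous_le _ _ _ _ (mix (1 / 2)) _ _ (continuousf _) s0) => // n;
  have [[_]] := yV n.
Qed.

(** Membership in the tube makes the deviation bound available at [x] itself, so the coarse margins
    are replaced by the actual rates. *)
Lemma saa_near_optP x : near_opt Y fh 0 eps0 x ->
  (forall i, f (Some i) x <= e) /\ f None x <= optval Y f + eps0 + e * (2 + theta / eta).
Proof.
move=> xP; have Vx := saa_near_opt_sub _ xP; have [[Yx fx] ox] := xP; split=> [i|].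
  have := dev (Some i) _ Vx; rewrite ler_norml => /andP[]; move: (fx i); slra.
have := dev None _ Vx; rewrite ler_norml => /andP[].
move: ox optval_saa_le; slra.
Qed.

(** The weight [a] balances the violation [D] at [x] against the slack [delta] at [u], so [z] is
    feasible. The distance is then measured through [z - u] instead of [x - u]: both [z] and [u]
    have constraint level 0, and [x - z] is [D / delta] times [z - u]. *)
Lemma dist_feasible_le (x u : 'rV[R]_d) (D delta r : R) :
  0 <= D -> 0 < delta -> 0 <= r ->
  near_opt Y f D r x -> near_opt Y f (- delta) r u ->
  (dist nrm x (feasible Y f 0) <= diam nrm (near_opt Y f 0 r) * (D / delta)%:E)%E.
Proof.
move=> D0 delta0 r0 [[Yx fx] ox] uP; have [[Yu fu] ou] := uP.
pose a := D / (D + delta); pose z := a *: u + (1 - a) *: x.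
have Dd : 0 < D + delta by slra.
have a01 : 0 <= a <= 1.
  by apply: divr_itv01; slra.
have /andP[a0 a1] := a01.
have fz i : f i z <= a * f i u + (1 - a) * f i x by exact: convex_function_segment.
have zP : near_opt Y f 0 r z.
  split; first split; first exact: convex_set_segment.
    move=> i; apply: (le_trans (fz _)).
    have a1' : 0 <= 1 - a by slra.
    have := ler_wpM2l a0 (fu i); have := ler_wpM2l a1' (fx i).
    have : a * (D + delta) = D by rewrite divfK// gt_eqF.
    slra.
  apply: (le_trans (fz _)).
  have a1' : 0 <= 1 - a by slra.
  have := ler_wpM2l a0 ou; have := ler_wpM2l a1' ox; slra.
have uP0 : near_opt Y f 0 r u by apply: near_optS uP => //; slra.
have [_ hom _] := nrm_norm.
have xz : nrm (x - z) = nrm (z - u) * (D / delta).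
  have -> : x - z = a *: (x - u) by apply/rowP => i; rewrite !mxE; ring.
  have -> : z - u = (1 - a) *: (x - u) by apply/rowP => i; rewrite !mxE; ring.
  rewrite !hom !ger0_norm//; last slra.
  by rewrite /a; field; rewrite !gt_eqF.
have : (dist nrm x (feasible Y f 0) <= (nrm (x - z))%:E)%E.
  by apply: ereal_inf_lbound; exists z => //; have [] := zP.
move=> /le_trans; apply; rewrite xz EFinM lee_wpmul2r//.
  by rewrite lee_fin divr_ge0// ltW.
exact: diam_ge.
Qed.

Lemma good_event_of_deviation {Omega : Type} (Fhat : Omega -> option I -> 'rV[R]_d -> R)
    (w : Omega) (sigmastar t RN DN : R) (N : nat) :
  Fhat w = fh -> 0 <= sigmastar ->
  e <= DN -> 2 * eps0 <= RN -> 2 * (e * (2 + theta / eta)) <= RN ->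
  good_event nrm Y f Fhat eta theta sigmastar eps0 t N RN DN w.
Proof.
move=> Fw sigmastar0 eDN epsRN eRN; rewrite /good_event/= Fw.
have te0 : 0 <= e * (theta / eta) by rewrite mulr_ge0 ?divr_ge0 ?ltW.
have incl x : near_opt Y fh 0 eps0 x -> near_opt Y f e RN x.
  move=> xP; have [xi x0] := saa_near_optP _ xP; split.
    by split=> //; have [[]] := xP.
  by move: x0; slra.
have RN0 : 0 <= RN by slra.
have xh : near_opt Y fh 0 eps0 xhat.
  split; first by have [] := xhatP.
  by rewrite (minimizer_optval _ _ _ xhatP); have /andP[? _] := eps0P; rewrite lerDl.
split.
- by move=> x /incl; apply: near_optS.
- rewrite -addeA; apply: (@le_trans _ _ ((RN / 2)%:E + maxe RN%:E (gap Y f DN))%E); last first.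
    rewrite -[leLHS]add0e leeD2r// lee_fin mulr_ge0//.
  have h1 := optval_saa_le.
  have h2 : f None xhat - e <= optval Y fh.
    rewrite (minimizer_optval _ _ _ xhatP).
    by have := dev None _ (saa_near_opt_sub _ xh); rewrite ler_norml => /andP[]; slra.
  have fxh : feasible Y f DN xhat.
    have [[Yh fh'] _] := incl _ xh; split=> // i; exact: le_trans eDN.
  have h3 : (optval_relaxed Y f DN <= (f None xhat)%:E)%E.
    by apply: ereal_inf_lbound; exists xhat.
  (* Only a sample value far below [optval Y f] calls for the gap: there [xhat] profits from the
     relaxed constraints, and [f None xhat] is still at least the relaxed value. *)
  have [le|lt] := leP (optval Y f - optval Y fh) (RN / 2).
    have : `|optval Y fh - optval Y f| <= RN / 2 by rewrite ler_norml; slra.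
    rewrite -lee_fin => /le_trans; apply.
    by rewrite leeDl// le_max lee_fin RN0.
  have -> : `|optval Y fh - optval Y f| = optval Y f - optval Y fh.
    by rewrite distrC ger0_norm//; slra.
  apply: (@le_trans _ _ ((RN / 2)%:E + gap Y f DN)%E); last first.
    by rewrite leeD2l// le_max lexx orbT.
  (* A relaxed value equal to -oo makes the gap +oo; the value +oo is excluded by [h3]. *)
  rewrite /gap; case: (optval_relaxed Y f DN) h3 => [r| |] //= h3; last first.
    by rewrite /= leey.
  rewrite -EFinD lee_fin; rewrite lee_fin in h3.
  by have := ler_norm (optval Y f - r); rewrite distrC; slra.
- move=> x xP; rewrite le_min; apply/andP; split.
    apply: (dist_feasible_le x xbar) => //.
    - slra.
    - exact: ltW.
    - have [[Yx fx] _] := incl _ xP; have [_ ox] := saa_near_opt_sub _ xP.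
      by split=> //; split=> // i; exact: le_trans eDN.
  (* For the second bound the Slater point is replaced by the mixture whose slack [e] equals the
     violation of [x]. The ratio is then 1, and the small price of that slack keeps the mixture
     within the level [RN]. *)
  apply: (@le_trans _ _ (diam nrm (near_opt Y f 0 RN) * (e / e)%:E)%E).
    have a01 : 0 <= e / eta <= 1.
      by apply: divr_itv01; slra.
    have uP : near_opt Y f (- e) RN (mix (e / eta)).
      apply: near_optS (slater_mix _ a01); first by rewrite divfK ?gt_eqF.
      by rewrite mulrAC -mulrA; slra.
    exact: (dist_feasible_le x _ e e RN (ltW e_gt0) e_gt0 RN0 (incl _ xP) uP).
  rewrite divff ?gt_eqF// mule1 muleC -[leLHS]mule1 lee_wpmul2l ?diam_ge0//.
  by rewrite lee_fin; slra.
Qed.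

End Deterministic.

(** * Exponential inequalities for i.i.d. samples *)

Section Tilting.
Import HBNNSimple.
Context {R : realType} {dXi dOmega : measure_display}.
Context {Xi : measurableType dXi} {Omega : measurableType dOmega}.
Variables (P : probability Xi R) (PP : probability Omega R).
Variables (U : Omega -> R) (xi : Omega -> Xi) (c : R).
Hypothesis U_ge0 : forall w, 0 <= U w.
Hypothesis measurableU : measurable_fun setT U.
Hypothesis measurable_xi : measurable_fun setT xi.
Hypothesis c_ge0 : 0 <= c.
Hypothesis tiltE : forall A, measurable A ->
  (\int[PP]_w (U w * \1_A (xi w))%:E = c%:E * P A)%E.

(** [tiltE] says on sets that the image under [xi] of the measure with density [U] is [c] times [P].
    Linearity carries this to simple functions, and monotone convergence, in the next lemma, to
    nonnegative functions. In the application [U] collects the factors of the other sample points,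
    so that one factor is split off a product without any product measure. *)
Lemma tilted_integral_nnsfun (h : {nnsfun Xi >-> R}) :
  (\int[PP]_w (U w * h (xi w))%:E = c%:E * \int[P]_s (h s)%:E)%E.
Proof.
pose s : seq R := finmap.enum_fset (fset_set (h @` setT)).
have s0 (i : 'I_(size s)) : 0 <= s`_i.
  have : s`_i \in s by rewrite mem_nth.
  by rewrite [_ \in s]in_fset_set// inE => -[x _ <-].
have mA (i : 'I_(size s)) : measurable (h @^-1` [set s`_i]) by [].
transitivity (\sum_(i < (size s)) (s`_i)%:E * (c%:E * P (h @^-1` [set s`_i])))%E.
  transitivity (\int[PP]_w (\sum_(i < (size s))
      (s`_i * (U w * \1_(h @^-1` [set s`_i]) (xi w)))%:E))%E.
    apply: eq_integral => w _; rewrite sumEFin; congr EFin.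
    rewrite (fimfunEord h) mulr_sumr; apply: eq_bigr => i _.
    by rewrite mulrCA.
  rewrite ge0_integral_sum//.
  - apply: eq_bigr => i _; rewrite -tiltE//.
    under eq_integral do rewrite EFinM.
    rewrite ge0_integralZl//.
    + apply/measurable_EFinP; apply: measurable_funM => //.
      by apply: measurableT_comp => //; exact: measurable_indic.
    + by move=> w _; rewrite lee_fin mulr_ge0// indicE.
    + by rewrite lee_fin.
  - move=> i; apply/measurable_EFinP; apply: measurable_funM => //.
    apply: measurable_funM => //.
    by apply: measurableT_comp => //; exact: measurable_indic.
  - by move=> i w _; rewrite lee_fin !mulr_ge0// indicE.
transitivity (c%:E * \sum_(i < (size s)) ((s`_i)%:E * P (h @^-1` [set s`_i])))%E.
  rewrite ge0_sume_distrr; last by move=> i _; rewrite mule_ge0// lee_fin.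
  by apply: eq_bigr => i _; rewrite muleCA.
congr (_ * _)%E.
transitivity (\int[P]_x (\sum_(i < (size s))
    (s`_i * \1_(h @^-1` [set s`_i]) x)%:E))%E; last first.
  by apply: eq_integral => w _; rewrite sumEFin -fimfunEord.
rewrite ge0_integral_sum//.
- apply: eq_bigr => i _.
  under eq_integral do rewrite EFinM.
  rewrite ge0_integralZl//.
  + by rewrite integral_indic// setIT.
  + by apply/measurable_EFinP; exact: measurable_indic.
  + by rewrite lee_fin.
- by move=> i; apply/measurable_EFinP; apply: measurable_funM => //; exact: measurable_indic.
- by move=> i w _; rewrite lee_fin mulr_ge0// indicE.
Qed.

Lemma tilted_integral (g : Xi -> R) : (forall x, 0 <= g x) -> measurable_fun setT g ->
  (\int[PP]_w (U w * g (xi w))%:E = c%:E * \int[P]_s (g s)%:E)%E.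
Proof.
move=> g0 mg.
have mEg : measurable_fun setT (EFin \o g) by apply/measurable_EFinP.
pose h := nnsfun_approx measurableT mEg.
have hg x : (h n x)%:E @[n --> \oo] --> (g x)%:E.
  by apply: cvg_nnsfun_approx => // y _; rewrite lee_fin.
have h_nd x m n : (m <= n)%N -> h m x <= h n x.
  by move=> mn; exact/lefP/nd_nnsfun_approx.
have lhs : (\int[PP]_w (U w * h n (xi w))%:E)%E @[n --> \oo] -->
    (\int[PP]_w (U w * g (xi w))%:E)%E.
  have -> : (fun w => (U w * g (xi w))%:E) =
      (fun w => lim ((U w * h n (xi w))%:E @[n --> \oo])).
    apply/funext => w; apply/esym/cvg_lim => //.
    under eq_fun do rewrite EFinM.
    by rewrite EFinM; apply: cvgeZl.
  apply: cvg_monotone_convergence => //.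
  - move=> n; apply/measurable_EFinP; apply: measurable_funM => //.
    exact: measurableT_comp.
  - by move=> n w _; rewrite lee_fin mulr_ge0.
  - move=> w _ m n mn; rewrite lee_fin ler_wpM2l//.
    exact: h_nd.
have rhs : (c%:E * \int[P]_s (h n s)%:E)%E @[n --> \oo] --> (c%:E * \int[P]_s (g s)%:E)%E.
  apply: cvgeZl => //.
  have -> : (fun s => (g s)%:E) = (fun s => lim ((h n s)%:E @[n --> \oo])).
    by apply/funext => s; apply/esym/cvg_lim.
  apply: cvg_monotone_convergence => //.
  - by move=> n; apply/measurable_EFinP.
  - by move=> n w _; rewrite lee_fin.
  - by move=> w _ m n mn; rewrite lee_fin; exact: h_nd.
apply: (cvg_unique _ lhs) => //.
apply: cvg_trans rhs; apply: near_eq_cvg; apply: nearW => n.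
by rewrite -tilted_integral_nnsfun.
Qed.

End Tilting.

Section Independence.
Context {R : realType} {dXi dOmega : measure_display}.
Context {Xi : measurableType dXi} {Omega : measurableType dOmega}.
Context {P : probability Xi R} {PP : probability Omega R} {N : nat}.
Variable xi : 'I_N -> Omega -> Xi.
Hypothesis iid : iid_sample P PP xi.

(** Independence is given on sets, so the induction must carry indicators along. Testing the factor
    of [a] against a set [B] moves [a] from [K] to [J]; once [K] is empty, only the product rule of
    [iid_sample] is left. *)
Lemma iid_integral_prod_indic (g : Xi -> R) (G : R) (K J : {set 'I_N})
    (A : 'I_N -> set Xi) :
  (forall x, 0 <= g x) -> measurable_fun setT g -> (\int[P]_s (g s)%:E = G%:E)%E ->
  (forall k, k \in K -> k \notin J) -> (forall k, measurable (A k)) ->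
  (\int[PP]_w ((\prod_(k in K) g (xi k w)) * \prod_(k in J) \1_(A k) (xi k w))%:E =
   (G ^+ #|K| * \prod_(k in J) fine (P (A k)))%:E)%E.
Proof.
move=> g0 mg gG; have [mxi lawxi ind] := iid.
have G0 : 0 <= G by rewrite -lee_fin -gG; apply: integral_ge0 => s _; rewrite lee_fin.
have [n] := ubnP #|K|; elim: n => // n IH in K J A *.
rewrite ltnS => Kn KJ mA.
have [->|[a aK]] := set_0Vmem K.
  rewrite cards0 expr0 mul1r.
  under eq_integral do rewrite big_set0 mul1r.
  have prod_indic w : \prod_(k in J) \1_(A k) (xi k w) =
      \1_(\bigcap_(k in [set` J]) (xi k @^-1` A k)) w :> R.
    rewrite indicE; case: (boolP (w \in _)) => wA.
      rewrite big1// => k kJ; rewrite indicE mem_set//.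
      by move: wA; rewrite inE => /(_ k kJ).
    have [k kJ wk] : exists2 k, k \in J & ~ A k (xi k w).
      apply: contrapT => nk; move/negP: wA; apply; rewrite inE => k /= kJ.
      by apply: contrapT => nA; apply: nk; exists k.
    by rewrite (bigD1 k)//= indicE memNset// mul0r.
  under eq_integral do rewrite prod_indic.
  rewrite integral_indic//; last first.
    by apply: fin_bigcap_measurable => // k _; rewrite -[X in measurable X]setTI; exact: mxi.
  rewrite setIT; apply: (etrans (ind J A mA)); rewrite -prodEFin; apply: eq_bigr => k _.
  by rewrite lawxi// fineK// fin_num_measure.
pose K' := K :\ a.
have aJ : a \notin J by exact: KJ.
have cK : #|K| = #|K'|.+1 by rewrite (cardsD1 a) aK.
pose U w := (\prod_(k in K') g (xi k w)) * \prod_(k in J) \1_(A k) (xi k w).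
pose c := G ^+ #|K'| * \prod_(k in J) fine (P (A k)).
have -> : G ^+ #|K| * \prod_(k in J) fine (P (A k)) = c * G.
  by rewrite cK exprS /c; ring.
transitivity (\int[PP]_w (U w * g (xi a w))%:E)%E.
  apply: eq_integral => w _; congr EFin.
  by rewrite (big_setD1 a)//= /U -/K'; ring.
have mindic k B : measurable B -> measurable_fun setT (fun w => \1_B (xi k w) : R).
  by move=> mB; apply: measurableT_comp => //; exact: measurable_indic.
rewrite (tilted_integral P PP U (xi a) c)//.
- by rewrite gG EFinM.
- by move=> w; rewrite /U mulr_ge0// prodr_ge0// => k _; rewrite ?indicE.
- apply: measurable_funM.
    under eq_fun do rewrite -big_enum.
    by apply: measurable_prod => k _; exact: (measurableT_comp mg (mxi k)).
  under eq_fun do rewrite -big_enum.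
  by apply: measurable_prod => k _; exact: mindic.
move=> B mB.
(* The test set [B] becomes the set attached to the index [a], which is new in [J]. *)
pose A' k := if k == a then B else A k.
have A'J w : (\prod_(k in a |: J) \1_(A' k) (xi k w) : R) =
    \1_B (xi a w) * \prod_(k in J) \1_(A k) (xi k w).
  rewrite big_setU1//= /A' eqxx; congr (_ * _); apply: eq_bigr => k kJ.
  by case: eqP => // ka; move: aJ; rewrite -ka kJ.
have PA'J : \prod_(k in a |: J) fine (P (A' k)) =
    fine (P B) * \prod_(k in J) fine (P (A k)).
  rewrite big_setU1//= /A' eqxx; congr (_ * _); apply: eq_bigr => k kJ.
  by case: eqP => // ka; move: aJ; rewrite -ka kJ.
transitivity (\int[PP]_w ((\prod_(k in K') g (xi k w)) *
    \prod_(k in a |: J) \1_(A' k) (xi k w))%:E)%E.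
  by apply: eq_integral => w _; congr EFin; rewrite A'J /U; ring.
rewrite IH//.
- rewrite PA'J -[P B in RHS]fineK ?fin_num_measure// -EFinM; congr EFin.
  by rewrite /c; ring.
- by rewrite -ltnS -cK.
- by move=> k; rewrite !inE => /andP[/negPf -> /KJ].
- by move=> k; rewrite /A'; case: eqP.
Qed.

Lemma iid_integral_prod (g : Xi -> R) (G : R) :
  (forall x, 0 <= g x) -> measurable_fun setT g -> (\int[P]_s (g s)%:E = G%:E)%E ->
  (\int[PP]_w (\prod_k g (xi k w))%:E = (G ^+ N)%:E)%E.
Proof.
move=> g0 mg gG.
have := iid_integral_prod_indic g G [set: 'I_N]%SET finset.set0 (fun=> setT) g0 mg gG.
rewrite big_set0 cardsT card_ord mulr1 => <-//; last by move=> k _; rewrite finset.in_set0.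
apply: eq_integral => w _; rewrite big_set0 mulr1; congr EFin.
by apply: eq_bigl => k; rewrite inE.
Qed.

(** The event is any measurable [B] on which the sum is large. This leaves room for side conditions,
    such as a bounded empirical second moment or the absence of large terms, which are what makes
    the sum of the [u] large. *)
Lemma iid_chernoff (u : Xi -> R) (G a : R) (B : set Omega) :
  measurable_fun setT u -> (\int[P]_s (expR (u s))%:E <= (expR G)%:E)%E ->
  measurable B -> B `<=` [set w | a <= \sum_k u (xi k w)] ->
  (PP B <= (expR (N%:R * G - a))%:E)%E.
Proof.
move=> mu uG mB Ba; have [mxi lawxi ind] := iid.
have meu : measurable_fun setT (fun s => expR (u s)) by exact: measurableT_comp.
have int0 : (0 <= \int[P]_s (expR (u s))%:E)%E.
  by apply: integral_ge0 => s _; rewrite lee_fin expR_ge0.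
have intfin : (\int[P]_s (expR (u s))%:E)%E \is a fin_num.
  by rewrite ge0_fin_numE//; exact: (le_lt_trans uG (ltry _)).
have := iid_integral_prod _ _ (fun x => expR_ge0 (u x)) meu (esym (fineK intfin)).
set E := fine _ => prodE.
have EG : E <= expR G by rewrite -lee_fin fineK.
have E0 : 0 <= E by rewrite fine_ge0.
have -> : PP B = (\int[PP]_w (\1_B w)%:E)%E by rewrite integral_indic// setIT.
apply: (@le_trans _ _ (\int[PP]_w (expR (- a) * \prod_k expR (u (xi k w)))%:E)%E).
  apply: ge0_le_integral => //.
  - by apply/measurable_EFinP; exact: measurable_indic.
  - apply/measurable_EFinP; apply: measurable_funM => //.
    by apply: measurable_prod => k _; exact: (measurableT_comp meu (mxi k)).
  - move=> w _; rewrite lee_fin indicE; case: (boolP (w \in B)) => wB.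
      rewrite -expR_sum -expRD -[leLHS]expR0 ler_expR.
      by move: wB; rewrite inE => /Ba /=; lra.
    by rewrite mulr_ge0 ?expR_ge0// prodr_ge0// => k _; exact: expR_ge0.
under eq_integral do rewrite EFinM.
rewrite ge0_integralZl//.
- rewrite prodE -EFinM lee_fin addrC expRD ler_wpM2l ?expR_ge0//.
  by rewrite expRM_natl lerXn2r// ?nnegrE ?expR_ge0.
- by apply/measurable_EFinP; apply: measurable_prod => k _; exact: (measurableT_comp meu (mxi k)).
- by move=> w _; rewrite lee_fin prodr_ge0// => k _; exact: expR_ge0.
Qed.

End Independence.

(** [expR (- (x - x ^+ 2))] is at least 1 - x + x^2, and (1 - x + x^2)(1 + x + x^2) = 1 + x^2 + x^4
    is at least 1. *)
Lemma expR_subX2_le {R : realType} (x : R) : expR (x - x ^+ 2) <= 1 + x + x ^+ 2.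
Proof.
have pos : 0 < 1 - x + x ^+ 2 by nra.
have : 1 - x + x ^+ 2 <= expR (- (x - x ^+ 2)).
  by apply: le_trans (expR_ge1Dx _); lra.
rewrite expRN -lef_pV2 ?posrE ?invr_gt0 ?expR_gt0// invrK => /le_trans; apply.
rewrite -[leLHS]mul1r ler_pdivrMr//.
have := sqr_ge0 (x ^+ 2); have := sqr_ge0 x; nra.
Qed.

(** Everything follows from (1 - x) exp x <= 1. For x <= 0 it is compared with (1 - x)(1 + x + x^2)
    = 1 - x^3 >= 1. For x > 0, multiplying by 1 + x gives exp x <= 1 + x + x^2 exp x, where exp x <=
    b. *)
Lemma expR_le_quadratic {R : realType} (x b : R) : 1 <= b -> x <= ln b ->
  expR x <= 1 + x + b * x ^+ 2.
Proof.
move=> b1 xb; have b0 : 0 < b by lra.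
have [x0|x0] := leP x 0.
  have h : 1 - x <= (expR x)^-1.
    by rewrite -expRN; exact: expR_ge1Dx.
  have e0 := expR_gt0 x.
  have h2 : (1 - x) * expR x <= 1 by rewrite -ler_pdivlMr// mul1r.
  have x2 : x ^+ 2 <= b * x ^+ 2 by rewrite ler_peMl// sqr_ge0.
  suff : expR x <= 1 + x + x ^+ 2 by lra.
  have x1 : 0 < 1 - x by lra.
  have : 0 <= x ^+ 2 * (- x) by rewrite mulr_ge0 ?sqr_ge0//; lra.
  rewrite !expr2 => h1.
  have h3 : (1 - x) * expR x <= (1 - x) * (1 + x + x * x) by lra.
  by rewrite (ler_pM2l x1) in h3.
have h : 1 - x <= (expR x)^-1 by rewrite -expRN; exact: expR_ge1Dx.
have e0 := expR_gt0 x.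
have h1 : (1 - x) * expR x <= 1 by rewrite -ler_pdivlMr// mul1r.
have eb : expR x <= b by rewrite -[leRHS](@lnK R b) ?posrE// ler_expR.
have h2 : x ^+ 2 * expR x <= x ^+ 2 * b by rewrite ler_wpM2l// sqr_ge0.
have h3 : (1 + x) * ((1 - x) * expR x) <= (1 + x) * 1 by rewrite ler_wpM2l//; lra.
rewrite expr2 in h2 *; lra.
Qed.

Section Moments.
Context {R : realType} {d : measure_display} {Xi : measurableType d}.
Variable P : probability Xi R.

Lemma integral_quadratic (X : Xi -> R) (l c v : R) :
  P.-integrable setT (EFin \o X) -> (\int[P]_s (X s)%:E = 0)%E ->
  (\int[P]_s (X s ^+ 2)%:E <= v%:E)%E -> 0 <= c ->
  (\int[P]_s (1 + l * X s + c * X s ^+ 2)%:E <= (1 + c * v)%:E)%E.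
Proof.
move=> iX X0 Xv c0.
have mX : measurable_fun setT X by apply/measurable_EFinP; exact: measurable_int iX.
have mX2 : measurable_fun setT (fun s => X s ^+ 2) by exact: measurable_funX.
have iX2 : P.-integrable setT (fun s => (X s ^+ 2)%:E).
  apply/integrableP; split; first exact/measurable_EFinP.
  under eq_integral => s _ do rewrite gee0_abs ?lee_fin ?sqr_ge0//.
  exact: (le_lt_trans Xv (ltry _)).
have i1 : P.-integrable setT (EFin \o cst (1 : R)).
  exact: finite_measure_integrable_cst.
have ilX : P.-integrable setT (fun s => l%:E * (X s)%:E)%E by exact: integrableZl.
have icX : P.-integrable setT (fun s => c%:E * (X s ^+ 2)%:E)%E by exact: integrableZl.
have i2 := integrableD measurableT i1 ilX.
have -> : (\int[P]_s (1 + l * X s + c * X s ^+ 2)%:E =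
    \int[P]_s (((1 : R)%:E + l%:E * (X s)%:E) + c%:E * (X s ^+ 2)%:E))%E.
  by apply: eq_integral => s _; rewrite -!EFinM -!EFinD.
rewrite integralD//= integralD//= !integralZl//= X0 mule0 adde0.
have -> : (\int[P]_x (1 : R)%:E = 1)%E.
  by rewrite integral_cst// mul1e; exact: probability_setT.
by rewrite EFinD leeD2l// EFinM lee_wpmul2l.
Qed.

(** A quadratic majorant is all that is asked of [exp u]: centring removes its linear term, and 1 +
    c v <= exp (c v). The self-normalized and the truncated exponent both enter this way. *)
Lemma exp_moment_le (X u : Xi -> R) (l c v : R) :
  measurable_fun setT u ->
  P.-integrable setT (EFin \o X) -> (\int[P]_s (X s)%:E = 0)%E ->
  (\int[P]_s (X s ^+ 2)%:E <= v%:E)%E -> 0 <= c ->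
  (forall s, expR (u s) <= 1 + l * X s + c * X s ^+ 2) ->
  (\int[P]_s (expR (u s))%:E <= (expR (c * v))%:E)%E.
Proof.
move=> mu iX X0 Xv c0 uX.
have mX : measurable_fun setT X by apply/measurable_EFinP; exact: measurable_int iX.
apply: (@le_trans _ _ (\int[P]_s (1 + l * X s + c * X s ^+ 2)%:E)%E).
  apply: ge0_le_integral => //.
  - by apply/measurable_EFinP; exact: measurableT_comp.
  - apply/measurable_EFinP; apply: measurable_funD.
      by apply: measurable_funD => //; exact: measurable_funM.
    by apply: measurable_funM => //; exact: measurable_funX.
  - by move=> s _; rewrite lee_fin.
apply: le_trans (integral_quadratic _ _ _ _ iX X0 Xv c0) _.
by rewrite lee_fin expR_ge1Dx.
Qed.

End Moments.

(** * Self-normalized tail bounds for sample sums *)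

Section Deviation.
Context {R : realType} {dXi dOmega : measure_display}.
Context {Xi : measurableType dXi} {Omega : measurableType dOmega}.
Context {P : probability Xi R} {PP : probability Omega R} {N : nat}.
Variable xi : 'I_N -> Omega -> Xi.
Hypothesis iid : iid_sample P PP xi.

Lemma measurable_sample_sum (g : Xi -> R) : measurable_fun setT g ->
  measurable_fun setT (fun w => \sum_k g (xi k w)).
Proof.
move=> mg; have [mxi _ _] := iid.
by apply: measurable_sum => k; exact: (measurableT_comp mg (mxi k)).
Qed.

Lemma measurable_emp_mean (g : Xi -> R) : measurable_fun setT g ->
  measurable_fun setT (emp_mean xi g).
Proof. by move=> mg; apply: measurable_funM => //; exact: measurable_sample_sum. Qed.

Lemma measurable_superlevel (g : Omega -> R) (a : R) :
  measurable_fun setT g -> measurable [set w | a < g w].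
Proof.
move=> mg; rewrite -[X in measurable X]setTI.
have -> : [set w | a < g w] = g @^-1` `]a, +oo[%classic.
  by apply/seteqP; split => w /=; rewrite in_itv/= andbT.
exact: mg.
Qed.

Lemma measurable_sum_superlevel (g : Xi -> R) (a : R) : measurable_fun setT g ->
  measurable [set w | a < \sum_k g (xi k w)].
Proof. by move=> mg; apply/measurable_superlevel/measurable_sample_sum. Qed.

(* The exponent [l X - l^2 X^2] is bounded, so no exponential moment of [X] is
   needed: the price is the empirical second moment. *)
Lemma self_normalized_tail (X : Xi -> R) (v b tau : R) :
  P.-integrable setT (EFin \o X) -> (\int[P]_s (X s)%:E = 0)%E ->
  (\int[P]_s (X s ^+ 2)%:E <= v%:E)%E -> (0 < N)%N -> 0 < v -> 0 <= tau -> 0 <= b ->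
  (PP ([set w | ((b + 2) * Num.sqrt (tau * (N%:R * v)) < \sum_k X (xi k w))%R] `\`
       [set w | (b * (N%:R * v) < \sum_k X (xi k w) ^+ 2)%R]) <= (expR (- tau))%:E)%E.
Proof.
move=> iX X0 Xv N0 v0 tau0 b0.
have mX : measurable_fun setT X by apply/measurable_EFinP; exact: measurable_int iX.
have Nv : 0 < N%:R * v by rewrite mulr_gt0// ltr0n.
(* With this [l] the moment costs exactly N l^2 v = tau, while on the event the exponents sum to at
   least (b + 2) tau - b tau = 2 tau. The difference is the required tau. *)
pose l := Num.sqrt (tau / (N%:R * v)).
have l0 : 0 <= l by exact: sqrtr_ge0.
have l2 : l ^+ 2 * (N%:R * v) = tau.
  by rewrite sqr_sqrtr ?divfK ?gt_eqF// divr_ge0// ltW.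
have lA : l * Num.sqrt (tau * (N%:R * v)) = tau.
  rewrite -sqrtrM ?divr_ge0 ?(ltW Nv)//.
  have -> : tau / (N%:R * v) * (tau * (N%:R * v)) = tau ^+ 2.
    by field; rewrite !gt_eqF// ltr0n.
  by rewrite sqrtr_sqr ger0_norm.
pose u s := l * X s - (l * X s) ^+ 2.
have mlX : measurable_fun setT (fun s => l * X s) by exact: measurable_funM.
have mu : measurable_fun setT u.
  by apply: measurable_funB => //; exact: measurable_funX.
have uG : (\int[P]_s (expR (u s))%:E <= (expR (l ^+ 2 * v))%:E)%E.
  apply: (exp_moment_le P X u l) => //; first exact: sqr_ge0.
  by move=> s; apply: (le_trans (expR_subX2_le _)); rewrite exprMn.
set B := (X in PP X).
have mB : measurable B.
  apply: measurableD; first exact: (measurable_sum_superlevel X).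
  by apply: (measurable_sum_superlevel (fun s => X s ^+ 2)); exact: measurable_funX.
have := iid_chernoff xi iid u _ ((1 + b + 1) * tau - b * tau) B mu uG mB.
have -> : N%:R * (l ^+ 2 * v) - ((1 + b + 1) * tau - b * tau) = - tau.
  by rewrite mulrCA l2; ring.
apply => w [/= hS /negP]; rewrite -leNgt => hV.
have -> : \sum_k u (xi k w) = l * (\sum_k X (xi k w)) - l ^+ 2 * \sum_k X (xi k w) ^+ 2.
  by rewrite sumrB -mulr_sumr; congr (_ - _); rewrite mulr_sumr; apply: eq_bigr => k _; rewrite exprMn.
have := ler_wpM2l l0 (ltW hS); rewrite mulrCA lA.
have := ler_wpM2l (sqr_ge0 l) hV; rewrite mulrCA l2.
by lra.
Qed.

Lemma self_normalized_tail2 (X : Xi -> R) (v b tau : R) :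
  P.-integrable setT (EFin \o X) -> (\int[P]_s (X s)%:E = 0)%E ->
  (\int[P]_s (X s ^+ 2)%:E <= v%:E)%E -> (0 < N)%N -> 0 < v -> 0 <= tau -> 0 <= b ->
  (PP ([set w | ((b + 2) * Num.sqrt (tau * (N%:R * v)) < `|\sum_k X (xi k w)|)%R] `\`
       [set w | (b * (N%:R * v) < \sum_k X (xi k w) ^+ 2)%R]) <= (2 * expR (- tau))%:E)%E.
Proof.
move=> iX X0 Xv N0 v0 tau0 b0.
have mX : measurable_fun setT X by apply/measurable_EFinP; exact: measurable_int iX.
have mX2 : measurable_fun setT (fun s => X s ^+ 2) by exact: measurable_funX.
have iNX : P.-integrable setT (EFin \o (fun s => - X s)).
  apply: (eq_integrable measurableT (fun s => - (EFin \o X) s)%E) => //.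
  exact: integrableN.
have NX0 : (\int[P]_s (- X s)%:E = 0)%E.
  under eq_integral do rewrite -mulN1r EFinM.
  by rewrite integralZl// X0 mule0.
have NX2 : (\int[P]_s ((- X s) ^+ 2)%:E <= v%:E)%E.
  by under eq_integral do rewrite sqrrN.
have B1 := self_normalized_tail X v b tau iX X0 Xv N0 v0 tau0 b0.
have B2 := self_normalized_tail _ v b tau iNX NX0 NX2 N0 v0 tau0 b0.
have E1 : [set w | b * (N%:R * v) < \sum_k (- X (xi k w)) ^+ 2] =
    [set w | b * (N%:R * v) < \sum_k X (xi k w) ^+ 2].
  by apply: eq_set => w; under eq_bigr do rewrite sqrrN.
have E2 : [set w | (b + 2) * Num.sqrt (tau * (N%:R * v)) < \sum_k - X (xi k w)] =
    [set w | (b + 2) * Num.sqrt (tau * (N%:R * v)) < - \sum_k X (xi k w)].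
  by apply: eq_set => w; rewrite sumrN.
rewrite E1 E2 in B2.
have -> : 2 * expR (- tau) = expR (- tau) + expR (- tau) by ring.
rewrite EFinD; apply: le_trans (leeD B1 B2).
have mD (Y : Xi -> R) : measurable_fun setT Y ->
   measurable ([set w | (b + 2) * Num.sqrt (tau * (N%:R * v)) < \sum_k Y (xi k w)] `\`
       [set w | b * (N%:R * v) < \sum_k X (xi k w) ^+ 2]).
  move=> mY; apply: measurableD; first exact: (measurable_sum_superlevel Y).
  exact: (measurable_sum_superlevel (fun s => X s ^+ 2)).
have mN : measurable ([set w | (b + 2) * Num.sqrt (tau * (N%:R * v)) < - \sum_k X (xi k w)] `\`
       [set w | b * (N%:R * v) < \sum_k X (xi k w) ^+ 2]).
  by rewrite -E2; apply: (mD (fun s => - X s)); exact: measurableT_comp.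
apply: le_trans (measureU2 PP (mD _ mX) mN).
apply: le_measure; rewrite ?inE.
- apply: measurableD; last exact: (measurable_sum_superlevel (fun s => X s ^+ 2) _ mX2).
  apply/measurable_superlevel; apply: measurableT_comp => //.
  exact: measurable_sample_sum.
- exact: measurableU (mD _ mX) mN.
- by move=> w [/= + nb]; rewrite ltr_normr => /orP[h|h]; [left|right].
Qed.

End Deviation.

(** * Tails under p-th moments *)

Lemma measure_bigsetU_le {R : realType} {d} {T : measurableType d}
    (mu : {measure set T -> \bar R}) (J : Type) (r : seq J) (B : J -> set T) :
  (forall j, measurable (B j)) ->
  (mu (\big[setU/set0]_(j <- r) B j) <= \sum_(j <- r) mu (B j))%E.
Proof.
move=> mB; elim: r => [|j r IH]; first by rewrite !big_nil measure0.
rewrite !big_cons; apply: le_trans (measureU2 mu (mB j) _) _.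
  exact: bigsetU_measurable.
exact: leeD2l.
Qed.

Section MomentTails.
Context {R : realType} {dXi dOmega : measure_display}.
Context {Xi : measurableType dXi} {Omega : measurableType dOmega}.
Context {P : probability Xi R} {PP : probability Omega R} {N : nat}.
Variable xi : 'I_N -> Omega -> Xi.
Hypothesis iid : iid_sample P PP xi.

Lemma union_superlevel_le (X : Xi -> R) (y q : R) :
  measurable_fun setT X -> (P [set s | (y < X s)%R] <= q%:E)%E ->
  (PP (\big[setU/set0]_(k < N) [set w | (y < X (xi k w))%R]) <= (N%:R * q)%:E)%E.
Proof.
move=> mX Pq; have [mxi lawxi _] := iid.
have mA : measurable [set s | y < X s].
  rewrite -[X in measurable X]setTI.
  have -> : [set s | y < X s] = X @^-1` `]y, +oo[%classic.
    by apply/seteqP; split => s /=; rewrite in_itv/= andbT.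
  exact: mX.
have mB k : measurable [set w | y < X (xi k w)].
  by rewrite -[X in measurable X]setTI; exact: (mxi k measurableT _ mA).
apply: (@le_trans _ _ (\sum_(k < N) PP [set w | (y < X (xi k w))%R])%E).
  exact: measure_bigsetU_le.
apply: (@le_trans _ _ (\sum_(k < N) q%:E)%E).
  by apply: lee_sum => k _; have := lawxi k _ mA; rewrite /preimage/= => ->.
by rewrite sumEFin sumr_const card_ord mulr_natl.
Qed.

Lemma moment_tail (X : Xi -> R) (p m y : R) :
  measurable_fun setT X -> 0 < p -> 0 < y -> 0 <= m ->
  (\int[P]_s (`|X s| `^ p)%:E <= (m `^ p)%:E)%E ->
  (P [set s | (y < X s)%R] <= ((m / y) `^ p)%:E)%E.
Proof.
move=> mX p0 y0 m0 Xm.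
have mA : measurable [set s | y < X s].
  rewrite -[X in measurable X]setTI.
  have -> : [set s | y < X s] = X @^-1` `]y, +oo[%classic.
    by apply/seteqP; split => s /=; rewrite in_itv/= andbT.
  exact: mX.
have yp : 0 < y `^ p by exact: powR_gt0.
have mXp : measurable_fun setT (fun s => `|X s| `^ p).
  by apply: (measurableT_comp (measurable_powR p)); exact: measurableT_comp.
have : ((y `^ p)%:E * P [set s | (y < X s)%R] <= \int[P]_s (`|X s| `^ p)%:E)%E.
  have -> : P [set s | y < X s] = (\int[P]_s (\1_[set s | y < X s] s)%:E)%E.
    by rewrite integral_indic// setIT.
  have m1 : measurable_fun setT (fun s => (\1_[set s | y < X s] s)%:E : \bar R).
    by apply/measurable_EFinP; exact: measurable_indic.
  have n1 s : setT s -> (0 <= (\1_[set s | y < X s] s)%:E :> \bar R)%E.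
    by move=> _; rewrite lee_fin indicE.
  have yp0 : (0 <= (y `^ p)%:E)%E by rewrite lee_fin ltW.
  rewrite -ge0_integralZl//.
  apply: ge0_le_integral => //.
  - by move=> s _; rewrite -EFinM lee_fin mulr_ge0 ?(ltW yp)// indicE.
  - by apply/measurable_EFinP; apply: measurable_funM => //; exact: measurable_indic.
  - exact/measurable_EFinP.
  - move=> s _; rewrite -EFinM lee_fin indicE; case: (boolP (s \in _)) => sA.
      move: sA; rewrite inE mulr1 => /= sA; apply: ge0_ler_powR.
      + exact: ltW.
      + by rewrite nnegrE ltW.
      + by rewrite nnegrE.
      + exact: le_trans (ltW sA) (ler_norm _).
    by rewrite mulr0 powR_ge0.
move=> /le_trans/(_ Xm).
rewrite -lee_pdivlMl// => /le_trans; apply.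
rewrite -EFinM lee_fin powRM ?invr_ge0 ?(ltW y0)// mulrC.
by rewrite -powR_inv1 ?(ltW y0)// powRAC powR_inv1 ?powR_ge0.
Qed.

(** Splitting at |X| = m replaces Jensen's inequality: below, X^2 <= m^2; above, X^2 <= m^(2 - p)
    |X|^p because p >= 2. The factor 2 is the price of the two pieces. *)
Lemma second_moment_le (X : Xi -> R) (p m : R) :
  measurable_fun setT X -> 2 <= p -> 0 < m ->
  (\int[P]_s (`|X s| `^ p)%:E <= (m `^ p)%:E)%E ->
  (\int[P]_s (X s ^+ 2)%:E <= (2 * m ^+ 2)%:E)%E.
Proof.
move=> mX p2 m0 Xm.
have mp : 0 < m `^ p by exact: powR_gt0.
have mXp : measurable_fun setT (fun s => `|X s| `^ p).
  by apply: (measurableT_comp (measurable_powR p)); exact: measurableT_comp.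
have key s : X s ^+ 2 <= m ^+ 2 + m ^+ 2 / m `^ p * `|X s| `^ p.
  have c0 : 0 <= m ^+ 2 / m `^ p by rewrite divr_ge0 ?sqr_ge0 ?ltW.
  have [le|lt] := leP `|X s| m.
    rewrite -[X s ^+ 2]real_normK ?num_real//.
    apply: (@le_trans _ _ (m ^+ 2)); first by rewrite lerXn2r ?nnegrE// ltW.
    by rewrite lerDl mulr_ge0 ?powR_ge0.
  apply: (@le_trans _ _ (m ^+ 2 / m `^ p * `|X s| `^ p)); last first.
    by rewrite lerDr sqr_ge0.
  rewrite mulrAC ler_pdivlMr// -[X s ^+ 2]real_normK ?num_real//.
  set x := `|X s| in lt *; have x0 : 0 < x by exact: lt_trans lt.
  have e2 z : 0 < z -> z `^ p = z ^+ 2 * z `^ (p - 2).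
    move=> z0; rewrite -powR_mulrn ?(ltW z0)// -powRD; first by congr powR; ring.
    by apply/implyP => _; rewrite gt_eqF.
  rewrite (e2 _ m0) (e2 _ x0) mulrCA ler_pM2l ?exprn_gt0// ler_pM2l ?exprn_gt0//.
  by apply: ge0_ler_powR; rewrite ?nnegrE; lra.
apply: (@le_trans _ _ (\int[P]_s ((m ^+ 2)%:E + (m ^+ 2 / m `^ p)%:E * (`|X s| `^ p)%:E))%E).
  apply: ge0_le_integral => //.
  - by move=> s _; rewrite lee_fin sqr_ge0.
  - by apply/measurable_EFinP; exact: measurable_funX.
  - apply: emeasurable_funD => //; apply: emeasurable_funM => //.
    exact/measurable_EFinP.
  - by move=> s _; rewrite -EFinM -EFinD lee_fin.
have c0 : 0 <= m ^+ 2 / m `^ p by rewrite divr_ge0 ?sqr_ge0 ?ltW.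
have mEXp : measurable_fun setT (fun s => (`|X s| `^ p)%:E) by exact/measurable_EFinP.
have Xp0 s : setT s -> (0 <= (`|X s| `^ p)%:E)%E by rewrite lee_fin powR_ge0.
have cXp0 s : setT s -> (0 <= (m ^+ 2 / m `^ p)%:E * (`|X s| `^ p)%:E)%E.
  by rewrite -EFinM lee_fin mulr_ge0 ?powR_ge0.
have m20 s : @setT Xi s -> (0 <= (m ^+ 2)%:E)%E by rewrite lee_fin sqr_ge0.
rewrite ge0_integralD//; last by apply: emeasurable_funM.
rewrite ge0_integralZl//.
have -> : (\int[P]_x (m ^+ 2)%:E = (m ^+ 2)%:E)%E.
  by rewrite integral_cst//= -[RHS]mule1; congr (_ * _)%E; exact: probability_setT.
rewrite mulr2n mulrDl mul1r EFinD leeD2l//.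
apply: (le_trans (lee_wpmul2l _ Xm)); first by rewrite lee_fin.
by rewrite -EFinM divfK// gt_eqF.
Qed.

End MomentTails.

(** * A Fuk-Nagaev inequality, and goodness from greatness *)

Section FukNagaev.
Context {R : realType} {dXi dOmega : measure_display}.
Context {Xi : measurableType dXi} {Omega : measurableType dOmega}.
Context {P : probability Xi R} {PP : probability Omega R} {N : nat}.
Variable xi : 'I_N -> Omega -> Xi.
Hypothesis iid : iid_sample P PP xi.
Hypothesis N_gt0 : (0 < N)%N.

(* Fuk--Nagaev: below the truncation level [y] the exponential bound is of the
   order of the [p]-th power that Markov's inequality gives above it. *)
Lemma fuk_nagaev (X : Xi -> R) (p kappa s : R) :
  P.-integrable setT (EFin \o X) -> (\int[P]_x (X x)%:E = 0)%E ->
  2 <= p -> 1 <= kappa -> 0 < s ->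
  (\int[P]_x (`|X x| `^ p)%:E <= ((kappa * s) `^ p)%:E)%E ->
  (PP [set w | (N%:R * s < \sum_k X (xi k w))%R] <=
    ((4 * expR 1 * kappa * Num.sqrt (p / N%:R)) `^ p)%:E)%E.
Proof.
move=> iX X0 p2 k1 s0 Xm.
have mX : measurable_fun setT X by apply/measurable_EFinP; exact: measurable_int iX.
have N0 : 0 < N%:R :> R by rewrite ltr0n.
have e2 : 2 <= expR 1 :> R by apply: le_trans (expR_ge1Dx 1); lra.
set a := kappa * Num.sqrt (p / N%:R).
have pN0 : 0 < p / N%:R by rewrite divr_gt0//; lra.
have a0 : 0 < a by rewrite mulr_gt0 ?sqrtr_gt0//; lra.
have a2 : a ^+ 2 = kappa ^+ 2 * p / N%:R.
  by rewrite exprMn sqr_sqrtr ?mulrA// ltW.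
rewrite -mulrA -/a.
have mS : measurable [set w | N%:R * s < \sum_k X (xi k w)].
  exact: (measurable_sum_superlevel xi iid X).
(* If the claimed bound is at least 1 there is nothing to prove; otherwise [a] is small, which
   yields both [1 <= W] and [p / N%:R <= 1]. *)
have [ge1|lt1] := leP 1 (4 * expR 1 * a).
  apply: (@le_trans _ _ 1%E); first exact: probability_le1.
  have one_p : 1 `^ p = 1 :> R by rewrite powR1.
  by rewrite lee_fin -[leLHS]one_p; apply: ge0_ler_powR; rewrite ?nnegrE; lra.
(* The level [y] makes the exponent on the event l N s = 2 p ln W for l = (ln W) / y. *)
pose y := N%:R * s / (2 * p).
have y0 : 0 < y by rewrite divr_gt0 ?mulr_gt0//; lra.
(* [W] is chosen so that exp (- p ln W) is already the target (sqrt 8 a)^p. The quadratic term of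
   the exponent is p (8 a^2 W ln W) ln W, at most p ln W since ln W <= W and 8 a^2 W^2 = 1; it uses
   up half of 2 p ln W. *)
pose W := (Num.sqrt 8 * a)^-1.
have s8 : 0 < Num.sqrt 8 :> R by rewrite sqrtr_gt0; lra.
have s8sq : Num.sqrt 8 ^+ 2 = 8 :> R by rewrite sqr_sqrtr//; lra.
have s8le : Num.sqrt 8 <= 2 * expR 1 :> R.
  have e4 : 2 * 2 <= expR 1 * expR 1 :> R by apply: ler_pM.
  rewrite -ler_sqr ?nnegrE ?(ltW s8) ?mulr_ge0 ?expR_ge0// s8sq exprMn !expr2.
  by move: e4; lra.
have s8a0 : 0 < Num.sqrt 8 * a by rewrite mulr_gt0.
have W1 : 1 <= W.
  rewrite invf_ge1//; have := ler_wpM2r (ltW a0) s8le.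
  by have := mulr_gt0 (expR_gt0 (1 : R)) a0; lra.
have W0 : 0 < W by lra.
have W2 : 8 * a ^+ 2 * W ^+ 2 = 1.
  by rewrite /W exprVn [(Num.sqrt 8 * a) ^+ 2]exprMn s8sq divff// gt_eqF// mulr_gt0 ?exprn_gt0//; lra.
have lW0 : 0 <= ln W by exact: ln_ge0.
have lWW : ln W <= W by apply: ltW; exact: ln_sublinear.
pose l := ln W / y.
have l0 : 0 <= l by rewrite divr_ge0// ltW.
pose u x := l * Num.min (X x) y.
have mu : measurable_fun setT u.
  by apply: measurable_funM => //; exact: measurable_minr.
have uX x : expR (u x) <= 1 + l * X x + W * l ^+ 2 * X x ^+ 2.
  (* Truncation at [y] caps the exponent at l y = ln W, so [W] serves as the coefficient in
     [expR_le_quadratic]. *)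
  have ul : u x <= ln W.
    rewrite /u -(divfK (lt0r_neq0 y0) (ln W)) -/l ler_wpM2l// ge_min lexx orbT//.
  apply: (le_trans (expR_le_quadratic _ _ W1 ul)).
  have h1 : u x <= l * X x by rewrite /u ler_wpM2l// ge_min lexx.
  have h2 : Num.min (X x) y ^+ 2 <= X x ^+ 2.
    rewrite /Num.min; case: ifPn => //; rewrite -leNgt => yX.
    by rewrite lerXn2r// nnegrE; lra.
  have h3 : W * u x ^+ 2 <= W * l ^+ 2 * X x ^+ 2.
    by rewrite /u exprMn mulrA ler_wpM2l// mulr_ge0 ?sqr_ge0// ltW.
  lra.
have m0 : 0 < kappa * s by rewrite mulr_gt0//; lra.
have X2 := second_moment_le (P := P) X p _ mX p2 m0 Xm.
have c0 : 0 <= W * l ^+ 2 by rewrite mulr_ge0 ?sqr_ge0 ?ltW.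
have uG := exp_moment_le P X u l _ _ mu iX X0 X2 c0 uX.
pose U := \big[setU/set0]_(k < N) [set w | (y < X (xi k w))%R].
have p0 : 0 < p by lra.
have Uq := union_superlevel_le xi iid X y _ mX (moment_tail X p _ y mX p0 y0 (ltW m0) Xm).
have mU : measurable U.
  have [mxi _ _] := iid; apply: bigsetU_measurable => k _.
  by apply: measurable_superlevel; exact: (measurableT_comp mX (mxi k)).
pose B := [set w | N%:R * s < \sum_k X (xi k w)] `\` U.
have mB : measurable B by exact: measurableD.
have Bsub : B `<=` [set w | l * (N%:R * s) <= \sum_k u (xi k w)].
  move=> w [/= hS nU].
  have -> : \sum_k u (xi k w) = l * \sum_k X (xi k w).
    rewrite mulr_sumr; apply: eq_bigr => k _; congr (_ * _); apply/min_idPl.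
    rewrite leNgt; apply/negP => yX; apply: nU.
    by rewrite /U (bigD1 k)//=; left.
  by rewrite ler_wpM2l// ltW.
have := iid_chernoff xi iid u _ _ B mu uG mB Bsub.
have -> : l * (N%:R * s) = 2 * p * ln W.
  by rewrite /l /y; field; rewrite !gt_eqF.
have ex : N%:R * (W * l ^+ 2 * (2 * (kappa * s) ^+ 2)) - 2 * p * ln W <= - (p * ln W).
  have -> : N%:R * (W * l ^+ 2 * (2 * (kappa * s) ^+ 2)) =
      p * (8 * a ^+ 2 * W * ln W) * ln W.
    by rewrite a2 /l /y; field; rewrite !gt_eqF.
  suff : p * (8 * a ^+ 2 * W * ln W) * ln W <= p * 1 * ln W by lra.
  have h1 : 8 * a ^+ 2 * W * ln W <= 1.
    rewrite -[leRHS]W2 [W ^+ 2]expr2 [leRHS]mulrA ler_wpM2l//.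
    by apply: mulr_ge0; [apply: mulr_ge0 => //; exact: sqr_ge0|exact: ltW].
  by rewrite ler_wpM2r// ler_wpM2l ?(ltW p0).
move=> Bq.
have {}Bq : (PP B <= ((2 * expR 1 * a) `^ p)%:E)%E.
  apply: (le_trans Bq); rewrite lee_fin.
  apply: (@le_trans _ _ (expR (- (p * ln W)))); first by rewrite ler_expR.
  have -> : expR (- (p * ln W)) = (Num.sqrt 8 * a) `^ p.
    rewrite -mulrN -lnV ?posrE// /W invrK mulrC expRM lnK// posrE//.
  apply: ge0_ler_powR; rewrite ?nnegrE; [lra|lra| |].
    by rewrite mulr_ge0 ?(ltW a0)// mulr_ge0 ?expR_ge0.
  by rewrite ler_wpM2r// ltW.
have pN1 : p / N%:R <= 1.
  have sq0 : 0 <= Num.sqrt (p / N%:R) by exact: sqrtr_ge0.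
  have sqa : Num.sqrt (p / N%:R) <= a by rewrite ler_peMl.
  have a1 : a < 1 by have := ler_wpM2r (ltW a0) e2; lra.
  by rewrite -[leLHS]sqr_sqrtr ?(ltW pN0)// exprn_ile1//; lra.
(* The factor N of the union bound is absorbed by (p / N)^(p / 2) <= p / N, valid as p >= 2 and p <=
   N; the remaining p is at most exp p. *)
have {}Uq : (PP U <= ((2 * expR 1 * a) `^ p)%:E)%E.
  apply: (le_trans Uq); rewrite lee_fin.
  have -> : kappa * s / y = 2 * a * Num.sqrt (p / N%:R).
    rewrite /a -!mulrA -expr2 sqr_sqrtr ?(ltW pN0)// /y; field.
    by rewrite !gt_eqF.
  have sq0 : 0 <= Num.sqrt (p / N%:R) by exact: sqrtr_ge0.
  have a20 : 0 <= 2 * a by lra.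
  rewrite (powRM _ a20 sq0) -powR12_sqrt ?(ltW pN0)// -powRrM.
  have pp : (p / N%:R) `^ (2^-1 * p) <= p / N%:R.
    by apply: ge1r_powR; [rewrite pN0|lra].
  have -> : 2 * expR 1 * a = (2 * a) * expR 1 by ring.
  rewrite (powRM _ a20 (expR_ge0 _)) -expRM mul1r mulrCA ler_wpM2l ?powR_ge0//.
  apply: (@le_trans _ _ p); last by apply: le_trans (expR_ge1Dx p); lra.
  by rewrite mulrC -ler_pdivlMr.
apply: (@le_trans _ _ (PP B + PP U)%E).
  apply: le_trans (measureU2 PP mB mU); apply: le_measure; rewrite ?inE//.
    exact: measurableU.
  by move=> w Sw; have [Uw|nU] := pselect (U w); [right|left].
apply: (le_trans (leeD Bq Uq)); rewrite -EFinD lee_fin.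
have -> : 4 * expR 1 * a = 2 * (2 * expR 1 * a) by ring.
have z0 : 0 <= 2 * expR 1 * a by rewrite mulr_ge0 ?(ltW a0)// mulr_ge0 ?expR_ge0.
rewrite (powRM _ _ z0)//; set z := _ `^ p.
have -> : z + z = 2 * z by ring.
by rewrite ler_wpM2r ?powR_ge0//; apply: le1r_powR; lra.
Qed.

(** As the expectation is at most [s2], an empirical mean above [2 * s2] forces the centred variable
    to have an empirical mean above [s2]. *)
Lemma great_good (h : Xi -> R) (p kappa s2 : R) :
  2 <= p -> 1 <= kappa -> 0 < s2 -> great P p kappa s2 h ->
  good P PP xi ((4 * expR 1 * kappa * Num.sqrt (p / N%:R)) `^ p) s2 h.
Proof.
move=> p2 k1 s0 [h0 mh Eh Lh]; split => //.
have ih : P.-integrable setT (EFin \o h).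
  apply/integrableP; split; first exact/measurable_EFinP.
  under eq_integral => s _ do rewrite gee0_abs ?lee_fin//.
  by rewrite unlock in Eh; exact: (le_lt_trans Eh (ltry _)).
set e := fine 'E_P[h] in Lh.
have eE : (\int[P]_s (h s)%:E = e%:E)%E.
  by rewrite /e unlock fineK//; exact: integrable_fin_num.
have es : e <= s2 by rewrite -lee_fin -eE; rewrite unlock in Eh.
pose X s := h s - e.
have ie : P.-integrable setT (EFin \o cst e) by exact: finite_measure_integrable_cst.
have iX : P.-integrable setT (EFin \o X).
  apply: (eq_integrable measurableT (fun s => (EFin \o h) s - (EFin \o cst e) s)%E) => //.
  exact: integrableB.
have X0 : (\int[P]_x (X x)%:E = 0)%E.
  under eq_integral do rewrite EFinB.
  rewrite (integralB _ ih ie)// eE.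
  have -> : (\int[P]_x (EFin \o cst e) x = e%:E)%E.
    apply: (etrans (integral_cst P measurableT e%:E)).
    by rewrite -[RHS]mule1; congr (_ * _)%E; exact: probability_setT.
  by rewrite subee.
have Xm : (\int[P]_x (`|X x| `^ p)%:E <= ((kappa * s2) `^ p)%:E)%E.
  have p0 : p != 0 by rewrite gt_eqF//; lra.
  have := poweR_Lnorm P (fun s => (X s)%:E) p0.
  rewrite /= => <-; rewrite -poweR_EFin; apply: gt0_ler_poweR => //.
  - lra.
  - by rewrite in_itv/= leey andbT; exact: Lnorm_ge0.
  - by rewrite in_itv/= leey andbT lee_fin mulr_ge0//; lra.
have := fuk_nagaev X p kappa s2 iX X0 p2 k1 s0 Xm.
apply: le_trans; apply: le_measure; rewrite ?inE.
- by apply: measurable_superlevel; exact: (measurable_emp_mean xi iid h mh).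
- by apply: (measurable_sum_superlevel xi iid X); apply: measurable_funB.
- move=> w; rewrite /= /emp_mean /X sumrB sumr_const card_ord -mulr_natl.
  have N0 : 0 < N%:R :> R by rewrite ltr0n.
  by rewrite ltr_pdivlMl//; have := ler_wpM2l (ltW N0) es; lra.
Qed.

End FukNagaev.

(** * Generic chaining *)

Section ChainingNets.
Context {R : realType} {d : nat} (nrm : 'rV[R]_d -> R) (alpha : R).
Hypothesis nrm_norm : is_norm nrm.
Hypothesis alpha_gt0 : 0 < alpha.
Implicit Types (M V : set 'rV[R]_d) (AA : nat -> set (set 'rV[R]_d)).

Lemma poweR_le (x y : \bar R) : (0 <= x)%E -> (x <= y)%E ->
  (x `^ alpha <= y `^ alpha)%E.
Proof.
move=> x0 xy; apply: gt0_ler_poweR => //; first exact: ltW.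
  by rewrite in_itv/= leey x0.
by rewrite in_itv/= leey (le_trans x0 xy).
Qed.

Lemma diam_partition_ge AA j A x y : AA j A -> A x -> A y ->
  ((nrm (x - y))%:E <= diam_partition nrm (AA j))%E.
Proof.
move=> AjA Ax Ay; apply: (le_trans (diam_ge nrm A x y Ax Ay)).
by apply: ereal_sup_ubound; exists A.
Qed.

(** The term of level 0 suffices: [AA 0%N] has a single cell, which is [M], and its weight is 1. *)
Lemma gamma2_ge M : M !=set0 -> (diam nrm M `^ alpha <= gamma2 nrm alpha M)%E.
Proof.
move=> M0; apply: le_ereal_inf_tmp => _ [AA [pAA A0 _] <-].
apply: le_trans (nneseries_lim_ge 1 _); last first.
  by move=> n _ _; rewrite mule_ge0 ?poweR_ge0// lee_fin powR_ge0.
rewrite big_nat1 mul0r powRr0 mul1e; apply: poweR_le; first exact: diam_ge0.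
have [cM _ _] := pAA 0%N.
have [A AAA] : AA 0%N !=set0.
  by case: M0 => x; rewrite -cM => -[A AAA _]; exists A.
suff -> : M = A by apply: ereal_sup_ubound; exists A.
rewrite -cM; apply/seteqP; split => x; last by exists A.
move=> [B AAB] Bx; suff -> : A = B by [].
have := A0; rewrite card_eq_le => /andP[/pcard_leP[phi] _].
have AB : phi A = phi B.
  have phi1 : set_fun (AA 0%N) `I_1 phi := 'funS_phi.
  have /= := phi1 _ AAA; have /= := phi1 _ AAB.
  by rewrite !ltnS !leqn0 => /eqP -> /eqP ->.
by apply: 'inj_phi => //; exact: mem_set.
Qed.

Lemma is_norm_gt0 x y : x <> y -> 0 < nrm (x - y).
Proof.
move=> xy; rewrite lt_neqAle is_norm_ge0// andbT eq_sym; apply/eqP => n0.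
by have [_ _ /(_ _ n0)/eqP] := nrm_norm; rewrite subr_eq0 => /eqP.
Qed.

Lemma diam_gt0 M x : M x -> M <> [set x] -> (0 < diam nrm M)%E.
Proof.
move=> Mx Mnx; have [y My xy] : exists2 y, M y & x <> y.
  apply: contrapT => nex; apply: Mnx; apply/seteqP; split => y; last by move=> ->.
  by move=> My; apply: contrapT => yx; apply: nex; exists y => //; exact: nesym.
by apply: lt_le_trans (diam_ge nrm M x y Mx My); rewrite lte_fin is_norm_gt0.
Qed.

Lemma chaining_ratioE M (D : R) : M !=set0 -> diam nrm M = D%:E ->
  (exists x, M = [set x]) /\ chaining_ratio nrm alpha M = 1%E \/
  0 < D /\ chaining_ratio nrm alpha M = (gamma2 nrm alpha M * (D `^ alpha)^-1%:E)%E.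
Proof.
move=> [x Mx] DE; rewrite /chaining_ratio; case: ifPn => /asboolP h; first by left.
right; have D0 : 0 < D.
  rewrite -lte_fin -DE; apply: (diam_gt0 _ x Mx) => Mx1; apply: h; by exists x.
by split => //; rewrite DE poweR_EFin inver gt_eqF// powR_gt0.
Qed.

(** This makes the chaining constant at least 1, so that phi is positive and can absorb numerical
    constants such as the 3 in [u]. *)
Lemma chaining_ratio_ge1 M (D : R) : M !=set0 -> diam nrm M = D%:E ->
  (1 <= chaining_ratio nrm alpha M)%E.
Proof.
move=> M0 DE; have [[_ ->]//|[D0 ->]] := chaining_ratioE _ _ M0 DE.
rewrite lee_pdivlMr ?powR_gt0// mul1e -poweR_EFin -DE.
exact: gamma2_ge.
Qed.

(* [T] at most halves distances, so the partitions of [M] pull back to [V]. *)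
Lemma gamma2_nets M V (T : 'rV[R]_d -> 'rV[R]_d) (x0 : 'rV[R]_d) (g : R) :
  V x0 -> (forall x, V x -> M (T x)) ->
  (forall x y, V x -> V y -> nrm (x - y) <= 2 * nrm (T x - T y)) ->
  (gamma2 nrm alpha M < g%:E)%E ->
  exists (pt : nat -> nat -> 'rV[R]_d) (delta : nat -> R),
    [/\ forall j k, V (pt j k), forall j, 0 <= delta j,
        forall j x, V x -> exists2 k, (k < 2 ^ (2 ^ j))%N &
          nrm (x - pt j k) `^ alpha <= delta j
      & forall n, \sum_(j < n) Num.sqrt 2 ^+ j * delta j <= 2 `^ alpha * g].
Proof.
move=> Vx0 TV T2 /ereal_inf_lt[_ [AA [pAA A0 cAA] <-] Ag].
pose a j := ((2 `^ (j%:R / 2))%:E * diam_partition nrm (AA j) `^ alpha)%E.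
have a0 j : (0 <= a j)%E by rewrite mule_ge0 ?poweR_ge0// lee_fin powR_ge0.
have partial n : (\sum_(0 <= j < n) a j < g%:E)%E.
  by apply: le_lt_trans Ag; apply: nneseries_lim_ge => j _ _; exact: a0.
(* Since the series has a finite sum, no level of this partition sequence has infinite diameter. *)
have Dfin j : (diam_partition nrm (AA j) `^ alpha)%E \is a fin_num.
  have aj : (a j < +oo)%E.
    apply: le_lt_trans (lt_trans (partial j.+1) (ltry g)).
    by rewrite big_nat_recr//= leeDr// sume_ge0.
  rewrite ge0_fin_numE ?poweR_ge0//; move: aj; rewrite /a.
  case: (_ `^ alpha)%E => [r| |//]; first by move=> _; exact: ltry.
  by rewrite gt0_muley// lte_fin powR_gt0.
pose D j := fine (diam_partition nrm (AA j) `^ alpha)%E.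
have D0 j : 0 <= D j by rewrite fine_ge0// poweR_ge0.
have DE j : (D j)%:E = (diam_partition nrm (AA j) `^ alpha)%E by rewrite /D fineK.
have sq2 j : 2 `^ (j%:R / 2) = Num.sqrt 2 ^+ j :> R.
  by rewrite -powR12_sqrt// mulrC powRrM powR_mulrn ?powR_ge0.
have cle j : (AA j #<= `I_(2 ^ (2 ^ j)))%card.
  case: j => [|j]; last exact: cAA.
  have := A0; rewrite card_eq_le => /andP[le1 _].
  by apply: card_le_trans le1 _; rewrite card_le_II.
have phiP j : exists phi : set 'rV[R]_d -> nat,
    (forall A, AA j A -> (phi A < 2 ^ (2 ^ j))%N) /\
    (forall A B, AA j A -> AA j B -> phi A = phi B -> A = B).
  have /pcard_leP[phi] := cle j; exists phi; split => [A AA_A|A B AA_A AA_B].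
    have phi1 : set_fun (AA j) `I_(2 ^ (2 ^ j)) phi := 'funS_phi.
    exact: (phi1 _ AA_A).
  by apply: 'inj_phi; exact: mem_set.
have [phi phiE] := choice phiP.
pose Q j k x := V x /\ exists A, [/\ AA j A, phi j A = k & A (T x)].
(* A point of [V] sent by [T] into the cell numbered [k]. Numbers without such a point get [x0],
   which keeps [pt j k] in [V]; the net property only concerns numbers of cells that are hit. *)
pose pt j k := if pselect (exists x, Q j k x) is left h then xget x0 [set x | Q j k x] else x0.
exists pt, (fun j => 2 `^ alpha * D j); split.
- move=> j k; rewrite /pt; case: pselect => // h.
  by have [] := xgetPex x0 h.
- by move=> j; rewrite mulr_ge0 ?powR_ge0.
- move=> j x Vx; have [cM _ _] := pAA j.
  have := TV _ Vx; rewrite -cM => -[A AA_A ATx].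
  have [phiL phiI] := phiE j.
  exists (phi j A); first exact: phiL.
  have Qx : exists x, Q j (phi j A) x by exists x; split => //; exists A.
  rewrite /pt; case: pselect => // h.
  have [Vy [B [AA_B BA BTy]]] := xgetPex x0 h; set y := xget _ _ in Vy BTy *.
  have {}BA := phiI _ _ AA_B AA_A BA; rewrite BA in BTy.
  apply: (@le_trans _ _ ((2 * nrm (T x - T y)) `^ alpha)).
    by apply: ge0_ler_powR; rewrite ?nnegrE ?mulr_ge0 ?is_norm_ge0 ?(ltW alpha_gt0)//; exact: T2.
  rewrite powRM ?is_norm_ge0// ler_wpM2l ?powR_ge0// -lee_fin DE -poweR_EFin.
  apply: poweR_le; first by rewrite lee_fin is_norm_ge0.
  exact: (diam_partition_ge _ _ A).
- move=> n.
  have -> : \sum_(j < n) Num.sqrt 2 ^+ j * (2 `^ alpha * D j) =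
      2 `^ alpha * \sum_(j < n) Num.sqrt 2 ^+ j * D j.
    by rewrite mulr_sumr; apply: eq_bigr => j _; rewrite mulrCA.
  rewrite ler_wpM2l ?powR_ge0// -lee_fin; apply: le_trans (ltW (partial n)).
  rewrite -sumEFin big_mkord; apply: lee_sum => j _.
  by rewrite /a -DE -EFinM sq2.
Qed.

(** [gamma2] is an infimum and [gamma2_nets] asks for a strict bound; the factor 2 in front of [r]
    provides it. When [M] is a single point, [T] cannot merge points, so [V] is a single point too
    and the constant net works. *)
Lemma chaining_nets M V (T : 'rV[R]_d -> 'rV[R]_d) (x0 : 'rV[R]_d) (D r : R) :
  V x0 -> (forall x, V x -> M (T x)) ->
  (forall x y, V x -> V y -> nrm (x - y) <= 2 * nrm (T x - T y)) ->
  diam nrm M = D%:E -> (chaining_ratio nrm alpha M <= r%:E)%E ->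
  exists (pt : nat -> nat -> 'rV[R]_d) (delta : nat -> R),
    [/\ forall j k, V (pt j k), forall j, 0 <= delta j,
        forall j x, V x -> exists2 k, (k < 2 ^ (2 ^ j))%N &
          nrm (x - pt j k) `^ alpha <= delta j
      & forall n, \sum_(j < n) Num.sqrt 2 ^+ j * delta j <=
          2 `^ alpha * (2 * r * D `^ alpha)].
Proof.
move=> Vx0 TV T2 DE ratio.
have M0 : M !=set0 by exists (T x0); exact: TV.
have r1 : 1 <= r by rewrite -lee_fin; apply: le_trans ratio; exact: chaining_ratio_ge1 DE.
have [[[m Mm] _]|[D0 ratioE]] := chaining_ratioE _ _ M0 DE.
  have V1 x : V x -> x = x0.
    move=> Vx; apply: contrapT => /is_norm_gt0.
    have := T2 _ _ Vx Vx0; have := TV _ Vx; have := TV _ Vx0.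
    by rewrite Mm => /= -> ->; rewrite subrr is_norm0// mulr0 leNgt => /negP.
  exists (fun _ _ => x0), (fun=> 0); split => //.
    move=> j x /V1 ->; exists 0%N; first by rewrite expn_gt0.
    by rewrite subrr is_norm0// powR0// gt_eqF.
  move=> n; rewrite big1 => [|j _]; last by rewrite mulr0.
  by rewrite !mulr_ge0 ?powR_ge0//; lra.
apply: (gamma2_nets M V T x0) => //.
rewrite ratioE lee_pdivrMr ?powR_gt0// -EFinM in ratio.
apply: le_lt_trans ratio _; rewrite lte_fin -mulrA ltr_pMl ?mulr_gt0 ?powR_gt0//; lra.
Qed.

End ChainingNets.

Lemma exists_pow2 {R : realType} (u : R) : 1 <= u -> exists j : nat, u <= 2 ^+ j <= 2 * u.
Proof.
move=> u1.
have ex : exists j, u <= 2 ^+ j.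
  exists (Num.bound u); apply: (@le_trans _ _ (Num.bound u)%:R).
    by apply: ltW; apply: archi_boundP; lra.
  by rewrite -natrX ler_nat ltnW// ltn_expl.
have [[|j] uj min] := ex_minnP ex; first by exists 0%N; rewrite uj expr0; lra.
exists j.+1; rewrite uj exprS ler_pM2l//= leNgt; apply/negP => uj'.
by have := min j (ltW uj'); rewrite ltnn.
Qed.

Lemma two_le_expR1 {R : realType} : 2 <= expR 1 :> R.
Proof. by apply: le_trans (expR_ge1Dx 1); lra. Qed.

(** There are 2^(3 * 2^j) links between levels j and j + 1, at most exp (3 * 2^j). The weight 8 in
    the exponent beats them, and the factor 2, with exp (-4 * 2^j) to spare. *)
Lemma pair_count_le {R : realType} (j : nat) :
  (2 ^ (2 ^ j) * 2 ^ (2 ^ j.+1))%:R * (2 * expR (- (8 * 2 ^+ j))) <=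
  expR (- (4 * 2 ^+ j)) :> R.
Proof.
have p1 : 1 <= 2 ^+ j :> R by rewrite exprn_ege1//; lra.
have e1 : 2 <= expR 1 :> R by exact: two_le_expR1.
have e3 : (2 ^ (2 ^ j) * 2 ^ (2 ^ j.+1))%:R <= expR (3 * 2 ^+ j) :> R.
  have -> : 3 * 2 ^+ j = (3 * 2 ^ j)%:R * 1 :> R by rewrite mulr1 natrM natrX.
  have -> : (2 ^ (2 ^ j) * 2 ^ (2 ^ j.+1) = 2 ^ (3 * 2 ^ j))%N.
    by rewrite -expnD expnS -mulSn.
  rewrite expRM_natl natrX.
  by rewrite lerXn2r// ?nnegrE// expR_ge0.
apply: (@le_trans _ _ (expR (3 * 2 ^+ j) * (expR 1 * expR (- (8 * 2 ^+ j))))).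
  apply: ler_pM => //.
  by rewrite ler_wpM2r ?expR_ge0.
by rewrite -!expRD ler_expR; lra.
Qed.

(** 4 (u + n) >= u + n + 3 since u >= 1. The right-hand side has the shape summed by
    [epsilon_trick0], with total [expR (- u) / 4] over all levels. *)
Lemma expR_geometric_le {R : realType} (u : R) (n : nat) (a : R) :
  1 <= u -> u + n%:R <= a -> expR (- (4 * a)) <= expR (- u) / 4 / 2 ^+ n.+1.
Proof.
move=> u1 ua; have n0 : 0 <= n%:R :> R by [].
have e1 : 2 <= expR 1 :> R by exact: two_le_expR1.
apply: (@le_trans _ _ (expR (- u - n.+3%:R * 1))); first by rewrite ler_expR -addn3 natrD; lra.
rewrite expRB expRM_natl.
have -> : expR (- u) / 4 / 2 ^+ n.+1 = expR (- u) / 2 ^+ n.+3.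
  by rewrite !exprS; field; rewrite expf_neq0.
rewrite ler_wpM2l ?expR_ge0// lef_pV2 ?posrE ?exprn_gt0 ?expR_gt0//.
by rewrite lerXn2r ?nnegrE ?expR_ge0.
Qed.

(** * Uniform deviation of a family with random Hoelder modulus *)

Section Chaining.
Context {R : realType} {dXi dOmega : measure_display}.
Context {Xi : measurableType dXi} {Omega : measurableType dOmega}.
Context {P : probability Xi R} {PP : probability Omega R} {N : nat}.
Variable xi : 'I_N -> Omega -> Xi.
Hypothesis iid : iid_sample P PP xi.
Hypothesis N_gt0 : (0 < N)%N.

Lemma integral_affine_le (q f : Xi -> R) (A a b : R) :
  (forall s, 0 <= q s) -> measurable_fun setT q -> (\int[P]_s (q s)%:E <= A%:E)%E ->
  0 <= a -> 0 <= b -> (forall s, 0 <= f s <= a * q s + b) -> measurable_fun setT f ->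
  (\int[P]_s (f s)%:E <= (a * A + b)%:E)%E.
Proof.
move=> q0 mq qA a0 b0 fq mf.
have mEq : measurable_fun setT (fun s => (q s)%:E) by exact/measurable_EFinP.
have q0E s : setT s -> (0 <= (q s)%:E)%E by rewrite lee_fin.
have aq0E s : setT s -> (0 <= a%:E * (q s)%:E)%E by rewrite -EFinM lee_fin mulr_ge0.
have maq : measurable_fun setT (fun s => a%:E * (q s)%:E)%E by exact: emeasurable_funM.
have b0E s : @setT Xi s -> (0 <= b%:E)%E by rewrite lee_fin.
apply: (@le_trans _ _ (\int[P]_s (a%:E * (q s)%:E + b%:E))%E).
  apply: ge0_le_integral => //.
  - by move=> s _; rewrite lee_fin; have /andP[] := fq s.
  - exact/measurable_EFinP.
  - exact: emeasurable_funD.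
  - by move=> s _; rewrite -EFinM -EFinD lee_fin; have /andP[] := fq s.
rewrite ge0_integralD// ge0_integralZl//.
have -> : (\int[P]_s b%:E = b%:E)%E.
  apply: (etrans (integral_cst P measurableT b%:E)).
  by rewrite -[RHS]mule1; congr (_ * _)%E; exact: probability_setT.
by rewrite EFinD EFinM leeD2r// lee_wpmul2l.
Qed.

Variables (d : nat) (nrm : 'rV[R]_d -> R) (alpha sigma : R).
Variables (H : 'rV[R]_d -> Xi -> R) (L : Xi -> R) (V : set 'rV[R]_d).
Hypothesis nrm_norm : is_norm nrm.
Hypotheses (alpha_gt0 : 0 < alpha) (alpha_le1 : alpha <= 1).
Hypothesis sigma_gt0 : 0 < sigma.
Hypothesis measurableH : forall x, V x -> measurable_fun setT (H x).
Hypothesis integrableH : forall x, V x -> P.-integrable setT (EFin \o H x).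
Hypothesis holderH : forall x y s, V x -> V y ->
  `|H x s - H y s| <= L s * nrm (x - y) `^ alpha.
Hypothesis measurableL2 : measurable_fun setT (fun s => L s ^+ 2).
Hypothesis L2_le : (\int[P]_s (L s ^+ 2)%:E <= (sigma ^+ 2)%:E)%E.

Definition deviation x w : R := emp_mean xi (H x) w - \int[P]_s H x s.

Let bigL2 : set Omega :=
  [set w | 2 * sigma ^+ 2 < emp_mean xi (fun s => L s ^+ 2) w].

Lemma holder_sqr x y s : V x -> V y ->
  (H x s - H y s) ^+ 2 <= L s ^+ 2 * (nrm (x - y) `^ alpha) ^+ 2.
Proof.
move=> Vx Vy; rewrite -[leLHS]real_normK ?num_real// -exprMn.
have h := holderH x y s Vx Vy.
by rewrite lerXn2r ?nnegrE//; exact: le_trans h.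
Qed.

Lemma mean_diff x y : V x -> V y ->
  \int[P]_s H x s - \int[P]_s H y s = \int[P]_s (H x s - H y s).
Proof. by move=> Vx Vy; rewrite RintegralB//; exact: integrableH. Qed.

(** Only the square of [L] is known to be measurable and integrable, so Cauchy-Schwarz is replaced
    by the pointwise bound L c <= (c / (2 sigma)) L^2 + sigma c / 2, whose integral is at most sigma
    c. *)
Lemma mean_diff_le x y : V x -> V y ->
  `|\int[P]_s H x s - \int[P]_s H y s| <= sigma * nrm (x - y) `^ alpha.
Proof.
move=> Vx Vy; rewrite mean_diff//.
set c := nrm (x - y) `^ alpha; have c0 : 0 <= c by exact: powR_ge0.
have mg : measurable_fun setT (fun s => H x s - H y s).
  by apply: measurable_funB; exact: measurableH.
have ig : P.-integrable setT (EFin \o (fun s => H x s - H y s)).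
  apply: (eq_integrable measurableT (fun s => (EFin \o H x) s - (EFin \o H y) s)%E) => //.
  by apply: integrableB => //; exact: integrableH.
apply: (le_trans (le_normr_Rintegral measurableT ig)).
have [c_gt0|] := ltP 0 c; last first.
  move=> c_le0; have ce : c = 0 by apply/le_anti; rewrite c_le0.
  have g0 s : H x s - H y s = 0.
    apply/eqP; rewrite -normr_le0.
    by have := holderH x y s Vx Vy; rewrite -/c ce mulr0.
  rewrite /Rintegral; under eq_integral do rewrite g0 normr0.
  by rewrite integral0 ce mulr0.
have s0 : 0 < sigma * c by rewrite mulr_gt0.
have := integral_affine_le (fun s => L s ^+ 2) (fun s => `|H x s - H y s|)
  (sigma ^+ 2) (c / (2 * sigma)) (sigma * c / 2) _ measurableL2 L2_le _ _ _ _.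
have -> : c / (2 * sigma) * sigma ^+ 2 + sigma * c / 2 = sigma * c.
  by field; rewrite gt_eqF.
move=> bound; rewrite -lee_fin /Rintegral fineK; last first.
  by apply: integrable_fin_num => //; have := integrable_abse ig; apply: eq_integrable.
apply: bound.
- by move=> s; exact: sqr_ge0.
- by rewrite divr_ge0// mulr_ge0// ltW.
- by rewrite divr_ge0// ltW.
- move=> s; rewrite normr_ge0/=; apply: (le_trans (holderH x y s Vx Vy)); rewrite -/c.
  have -> : c / (2 * sigma) * L s ^+ 2 + sigma * c / 2 =
      L s * c + c / (2 * sigma) * (L s - sigma) ^+ 2 by field; rewrite gt_eqF.
  by rewrite lerDl mulr_ge0 ?sqr_ge0// divr_ge0// mulr_ge0// ltW.
- exact: measurableT_comp.
Qed.

Lemma emp_meanB (f g : Xi -> R) w :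
  emp_mean xi f w - emp_mean xi g w = N%:R^-1 * \sum_k (f (xi k w) - g (xi k w)).
Proof. by rewrite /emp_mean -mulrBr sumrB. Qed.

(** The modulus depends on [w] and is not controlled uniformly. This is enough to let the chain tend
    to its end point with [w] fixed. *)
Lemma deviation_holder x y w : V x -> V y ->
  `|deviation x w - deviation y w| <=
    (emp_mean xi (fun s => `|L s|) w + sigma) * nrm (x - y) `^ alpha.
Proof.
move=> Vx Vy.
have -> : deviation x w - deviation y w =
    (emp_mean xi (H x) w - emp_mean xi (H y) w) -
    (\int[P]_s H x s - \int[P]_s H y s) by rewrite /deviation; ring.
apply: (le_trans (ler_normB _ _)); rewrite mulrDl lerD ?mean_diff_le//.
rewrite emp_meanB normrM ger0_norm ?invr_ge0// /emp_mean -mulrA ler_wpM2l ?invr_ge0//.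
apply: (le_trans (ler_norm_sum _ _ _)); rewrite mulr_suml; apply: ler_sum => k _.
apply: (le_trans (holderH x y _ Vx Vy)).
by rewrite ler_wpM2r ?powR_ge0// ler_norm.
Qed.

(** Removing [bigL2] from every pair event allows its probability to be paid once per index instead
    of once per pair. *)
Let pair_bad tau x y : set Omega :=
  [set w | 8 * sigma * nrm (x - y) `^ alpha * Num.sqrt (tau / N%:R) <
           `|deviation x w - deviation y w|] `\` bigL2.

Lemma measurable_bigL2 : measurable bigL2.
Proof. by apply: measurable_superlevel; exact: (measurable_emp_mean xi iid _ measurableL2). Qed.

Lemma measurable_deviation x : V x -> measurable_fun setT (deviation x).
Proof.
move=> Vx; apply: measurable_funB => //.
exact: (measurable_emp_mean xi iid _ (measurableH x Vx)).
Qed.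

Lemma measurable_pair_bad tau x y : V x -> V y -> measurable (pair_bad tau x y).
Proof.
move=> Vx Vy; apply: measurableD; last exact: measurable_bigL2.
apply: measurable_superlevel; apply: measurableT_comp => //.
by apply: measurable_funB; exact: measurable_deviation.
Qed.

(** The centred increment satisfies X^2 <= 2 c^2 L^2 + 2 (sigma c)^2, so v = 4 (sigma c)^2 bounds
    its second moment, and off [bigL2] its empirical second moment is at most 6 (sigma c)^2 < 2 v.
    Thus b = 2 is admissible, and 4 sqrt (tau N v) / N gives the constant 8. *)
Lemma pair_bad_le tau x y : V x -> V y -> 0 <= tau ->
  (PP (pair_bad tau x y) <= (2 * expR (- tau))%:E)%E.
Proof.
move=> Vx Vy tau0; set c := nrm (x - y) `^ alpha.
have c0 : 0 <= c by exact: powR_ge0.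
have [c_gt0|c_le0] := ltP 0 c; last first.
  have ce : c = 0 by apply/le_anti; rewrite c_le0.
  suff -> : pair_bad tau x y = set0 by rewrite measure0 lee_fin mulr_ge0 ?expR_ge0.
  apply/seteqP; split => // w [/= + _].
  have := deviation_holder x y w Vx Vy; rewrite -/c ce !mulr0 mul0r => h1 h2.
  by have := lt_le_trans h2 h1; rewrite ltxx.
have N0 : 0 < N%:R :> R by rewrite ltr0n.
pose m := \int[P]_s H x s - \int[P]_s H y s.
have mle : m ^+ 2 <= (sigma * c) ^+ 2.
  rewrite -[leLHS]real_normK ?num_real// lerXn2r ?nnegrE ?mulr_ge0 ?(ltW sigma_gt0)//.
  exact: mean_diff_le.
pose X s := H x s - H y s - m.
have ig : P.-integrable setT (EFin \o (fun s => H x s - H y s)).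
  apply: (eq_integrable measurableT (fun s => (EFin \o H x) s - (EFin \o H y) s)%E) => //.
  by apply: integrableB => //; exact: integrableH.
have im : P.-integrable setT (EFin \o cst m) by exact: finite_measure_integrable_cst.
have iX : P.-integrable setT (EFin \o X).
  apply: (eq_integrable measurableT
    (fun s => (EFin \o (fun s => (H x s - H y s)%R)) s - (EFin \o cst m) s)%E) => //.
  exact: integrableB.
have X0 : (\int[P]_s (X s)%:E = 0)%E.
  under eq_integral do rewrite EFinB.
  rewrite (integralB _ ig im)//.
  have -> : (\int[P]_x (EFin \o cst m) x = m%:E)%E.
    apply: (etrans (integral_cst P measurableT m%:E)).
    by rewrite -[RHS]mule1; congr (_ * _)%E; exact: probability_setT.
  rewrite /m mean_diff// /Rintegral fineK ?subee//; exact: integrable_fin_num.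
have mX : measurable_fun setT X by apply/measurable_EFinP; exact: measurable_int iX.
have Xsq s : X s ^+ 2 <= 2 * c ^+ 2 * L s ^+ 2 + 2 * (sigma * c) ^+ 2.
  have := holder_sqr x y s Vx Vy; rewrite -/c /X.
  move: mle; generalize (H x s - H y s) => g h1 h2.
  have := sqr_ge0 (g + m); rewrite sqrrB sqrrD; lra.
have X2 : (\int[P]_s (X s ^+ 2)%:E <= (4 * (sigma * c) ^+ 2)%:E)%E.
  have := integral_affine_le (fun s => L s ^+ 2) (fun s => X s ^+ 2)
    (sigma ^+ 2) (2 * c ^+ 2) (2 * (sigma * c) ^+ 2) _ measurableL2 L2_le _ _ _ _.
  have -> : 2 * c ^+ 2 * sigma ^+ 2 + 2 * (sigma * c) ^+ 2 = 4 * (sigma * c) ^+ 2.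
    by rewrite exprMn; ring.
  apply.
  - by move=> s; exact: sqr_ge0.
  - by rewrite mulr_ge0// sqr_ge0.
  - by rewrite mulr_ge0// sqr_ge0.
  - by move=> s; rewrite sqr_ge0 Xsq.
  - exact: measurable_funX.
have v0 : 0 < 4 * (sigma * c) ^+ 2 by rewrite mulr_gt0// exprn_gt0// mulr_gt0.
have b0 : 0 <= 2 :> R by [].
apply: le_trans (self_normalized_tail2 xi iid X _ 2 tau iX X0 X2 N_gt0 v0 tau0 b0).
apply: le_measure; rewrite ?inE.
- exact: measurable_pair_bad.
- apply: measurableD.
    apply: measurable_superlevel; apply: measurableT_comp => //.
    exact: (measurable_sample_sum xi iid X mX).
  apply: (measurable_sum_superlevel xi iid (fun s => X s ^+ 2)).
  exact: measurable_funX.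
- move=> w [/= hS nL].
  have sX : \sum_k X (xi k w) = N%:R * (deviation x w - deviation y w).
    have -> : deviation x w - deviation y w =
      (emp_mean xi (H x) w - emp_mean xi (H y) w) - m by rewrite /deviation /m; ring.
    rewrite emp_meanB /X sumrB sumr_const card_ord mulrBr mulrA divff ?gt_eqF// mul1r.
    by rewrite mulr_natl.
  split.
    rewrite sX normrM (ger0_norm (ltW N0)).
    have -> : (2 + 2) * Num.sqrt (tau * (N%:R * (4 * (sigma * c) ^+ 2))) =
        N%:R * (8 * sigma * c * Num.sqrt (tau / N%:R)).
      have -> : tau * (N%:R * (4 * (sigma * c) ^+ 2)) =
          (2 * sigma * c * N%:R) ^+ 2 * (tau / N%:R) by field; rewrite gt_eqF.
      rewrite sqrtrM ?sqr_ge0// sqrtr_sqr ger0_norm; first by ring.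
      by rewrite mulr_ge0 ?(ltW N0)// !mulr_ge0// ltW.
    by rewrite ltr_pM2l.
  move=> hV; apply: nL; rewrite /bigL2/= /emp_mean ltr_pdivlMl//.
  have : \sum_k X (xi k w) ^+ 2 <=
      2 * c ^+ 2 * (\sum_k L (xi k w) ^+ 2) + N%:R * (2 * (sigma * c) ^+ 2).
    have -> : N%:R * (2 * (sigma * c) ^+ 2) = \sum_(k < N) 2 * (sigma * c) ^+ 2.
      by rewrite sumr_const card_ord mulr_natl.
    rewrite mulr_sumr -big_split/=.
    by apply: ler_sum => k _; exact: Xsq.
  move=> /(lt_le_trans hV).
  have -> : 2 * (N%:R * (4 * (sigma * c) ^+ 2)) =
      2 * c ^+ 2 * (N%:R * (3 * sigma ^+ 2)) + N%:R * (2 * (sigma * c) ^+ 2) by rewrite exprMn; ring.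
  rewrite ltrD2r ltr_pM2l ?mulr_gt0 ?exprn_gt0// => /(le_lt_trans _); apply.
  have := mulr_ge0 (ltW N0) (sqr_ge0 sigma); lra.
Qed.

Variables (xs : 'rV[R]_d) (pt : nat -> nat -> 'rV[R]_d) (delta : nat -> R) (G Dl u : R).
Hypothesis Vxs : V xs.
Hypothesis ptV : forall j k, V (pt j k).
Hypothesis delta_ge0 : forall j, 0 <= delta j.
Hypothesis netV : forall j x, V x ->
  exists2 k, (k < 2 ^ (2 ^ j))%N & nrm (x - pt j k) `^ alpha <= delta j.
Hypothesis delta_sum : forall n, \sum_(j < n) Num.sqrt 2 ^+ j * delta j <= G.
Hypothesis V_diam : forall x y, V x -> V y -> nrm (x - y) `^ alpha <= Dl.
Hypothesis u_ge1 : 1 <= u.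

Let tau j : R := 8 * 2 ^+ j.

Lemma tau_ge0 j : 0 <= tau j.
Proof. by rewrite mulr_ge0// exprn_ge0. Qed.

Let bad_start j : set Omega :=
  \big[setU/set0]_(k < 2 ^ (2 ^ j)) pair_bad (tau j) (pt j k) xs.

Let bad_link j : set Omega :=
  \big[setU/set0]_(kl : 'I_(2 ^ (2 ^ j)) * 'I_(2 ^ (2 ^ j.+1)))
    pair_bad (tau j) (pt j.+1 kl.2) (pt j kl.1).

Lemma bad_start_le j n : u + n%:R <= 2 ^+ j ->
  (PP (bad_start j) <= (expR (- u) / 4 / 2 ^+ n.+1)%:E)%E.
Proof.
move=> uj.
apply: (le_trans (measure_bigsetU_le PP _ (index_enum _)
  (fun k : 'I_(2 ^ (2 ^ j)) => pair_bad (tau j) (pt j k) xs) _)).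
  by move=> k; exact: measurable_pair_bad.
apply: (@le_trans _ _ (\sum_(k < 2 ^ (2 ^ j)) (2 * expR (- tau j))%:E)%E).
  by apply: lee_sum => k _; apply: pair_bad_le => //; exact: tau_ge0.
rewrite sumEFin sumr_const card_ord lee_fin -[leLHS]mulr_natl.
apply: (le_trans _ (expR_geometric_le u n _ u_ge1 uj)).
apply: (le_trans _ (pair_count_le j)); rewrite ler_wpM2r ?mulr_ge0 ?expR_ge0//.
by rewrite ler_nat leq_pmulr// expn_gt0.
Qed.

Lemma bad_link_le j n : u + n%:R <= 2 ^+ j ->
  (PP (bad_link j) <= (expR (- u) / 4 / 2 ^+ n.+1)%:E)%E.
Proof.
move=> uj.
apply: (le_trans (measure_bigsetU_le PP _ (index_enum _)
  (fun kl : 'I_(2 ^ (2 ^ j)) * 'I_(2 ^ (2 ^ j.+1)) =>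
    pair_bad (tau j) (pt j.+1 kl.2) (pt j kl.1)) _)).
  by move=> k; exact: measurable_pair_bad.
apply: (@le_trans _ _ (\sum_(kl : 'I_(2 ^ (2 ^ j)) * 'I_(2 ^ (2 ^ j.+1)))
    (2 * expR (- tau j))%:E)%E).
  by apply: lee_sum => k _; apply: pair_bad_le => //; exact: tau_ge0.
rewrite sumEFin sumr_const card_prod !card_ord lee_fin -[leLHS]mulr_natl.
apply: (le_trans _ (expR_geometric_le u n _ u_ge1 uj)).
exact: pair_count_le.
Qed.

Lemma not_pair_bad t x y w : ~ bigL2 w -> ~ pair_bad t x y w ->
  `|deviation x w - deviation y w| <=
    8 * sigma * nrm (x - y) `^ alpha * Num.sqrt (t / N%:R).
Proof. by move=> nL nB; rewrite leNgt; apply/negP => h; apply: nB. Qed.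

Lemma sqrt_tau j : Num.sqrt (tau j / N%:R) = Num.sqrt (8 / N%:R) * Num.sqrt 2 ^+ j.
Proof.
have -> : tau j / N%:R = 8 / N%:R * 2 ^+ j by rewrite /tau mulrAC.
rewrite sqrtrM ?divr_ge0//; congr (_ * _).
elim: j => [|j IH]; first by rewrite !expr0 sqrtr1.
by rewrite !exprS sqrtrM// IH.
Qed.

(* The chain starts at the level [j0] with [2 ^ j0] of order [u]: below it the
   union bound would cost more than the single step from [xs]. *)
Lemma chaining_bound : exists Bad : set Omega,
  [/\ measurable Bad, (PP Bad <= (expR (- u))%:E)%E &
   forall w, ~ Bad w -> ~ bigL2 w -> forall x, V x ->
     `|deviation x w - deviation xs w| <=
       8 * sigma * Num.sqrt (8 / N%:R) * (Dl * Num.sqrt (2 * u) + 4 * G)].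
Proof.
have [j0 /andP[uj0 j0u]] := exists_pow2 u u_ge1.
have ujn n : u + n%:R <= 2 ^+ (j0 + n).
  have h1 : 1 + n%:R <= 2 ^+ n :> R by rewrite -natrX nat1r ler_nat ltn_expl.
  have j1 : 1 <= 2 ^+ j0 :> R by exact: le_trans uj0.
  have n0 : 0 <= n%:R :> R by [].
  rewrite exprD; apply: (@le_trans _ _ (2 ^+ j0 * (1 + n%:R))).
    by rewrite mulrDr mulr1 lerD// ler_peMl.
  by rewrite ler_wpM2l//; lra.
have e0 : 0 <= expR (- u) / 4 by rewrite divr_ge0// expR_ge0.
have mlink n : measurable (bad_link (j0 + n)).
  by apply: bigsetU_measurable => k _; exact: measurable_pair_bad.
have mlinks : measurable (\bigcup_n bad_link (j0 + n)).
  exact: bigcupT_measurable.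
have mstart : measurable (bad_start j0).
  by apply: bigsetU_measurable => k _; exact: measurable_pair_bad.
exists (bad_start j0 `|` \bigcup_n bad_link (j0 + n)); split.
- exact: measurableU.
- apply: le_trans (measureU2 PP mstart mlinks) _.
  have hs : (PP (bad_start j0) <= (expR (- u) / 4)%:E)%E.
    have u0 : u + 0%:R <= 2 ^+ j0 by rewrite addr0.
    apply: (le_trans (bad_start_le _ _ u0)); rewrite lee_fin.
    by rewrite ler_pdivrMr// ler_peMr//; lra.
  have hl : (PP (\bigcup_n bad_link (j0 + n)) <= (expR (- u) / 4)%:E)%E.
    apply: (@le_trans _ _ (\sum_(0 <= n <oo) PP (bad_link (j0 + n)))%E).
      exact: measure_sigma_subadditive.
    apply: le_trans (epsilon_trick0 xpredT e0).
    apply: lee_nneseries => // n _; rewrite natrX; exact: (bad_link_le _ _ (ujn n)).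
  apply: (le_trans (leeD hs hl)); rewrite -EFinD lee_fin.
  by have := expR_ge0 (- u); lra.
move=> w /not_orP[nstart nlinks] nL x Vx.
have start k : (k < 2 ^ (2 ^ j0))%N -> ~ pair_bad (tau j0) (pt j0 k) xs w.
  move=> kj Bk; apply: nstart; rewrite /bad_start (bigD1 (Ordinal kj))//=; by left.
have link n k l : (k < 2 ^ (2 ^ (j0 + n)))%N -> (l < 2 ^ (2 ^ (j0 + n).+1))%N ->
    ~ pair_bad (tau (j0 + n)) (pt (j0 + n).+1 l) (pt (j0 + n) k) w.
  move=> kj lj Bkl; apply: nlinks; exists n => //.
  by rewrite /bad_link (bigD1 (Ordinal kj, Ordinal lj))//=; left.
have /choice[kx kxP] : forall j, exists k,
    (k < 2 ^ (2 ^ j))%N /\ nrm (x - pt j k) `^ alpha <= delta j.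
  by move=> j; have [k kj xk] := netV j x Vx; exists k.
pose q n := pt (j0 + n) (kx (j0 + n)%N).
pose c := 8 * sigma * Num.sqrt (8 / N%:R).
have c0 : 0 <= c by rewrite !mulr_ge0 ?sqrtr_ge0// ltW.
have qstart : `|deviation (q 0%N) w - deviation xs w| <= c * (Dl * Num.sqrt (2 * u)).
  have := not_pair_bad _ _ _ _ nL (start _ (kxP j0).1).
  rewrite /q addn0 sqrt_tau => /le_trans; apply.
  have -> : 8 * sigma * nrm (pt j0 (kx j0) - xs) `^ alpha *
      (Num.sqrt (8 / N%:R) * Num.sqrt 2 ^+ j0) =
      c * (nrm (pt j0 (kx j0) - xs) `^ alpha * Num.sqrt 2 ^+ j0) by rewrite /c; ring.
  rewrite ler_wpM2l//; apply: ler_pM; rewrite ?powR_ge0 ?exprn_ge0 ?sqrtr_ge0//.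
    exact: V_diam.
  rewrite -ler_sqr ?nnegrE ?exprn_ge0 ?sqrtr_ge0// -exprM mulnC exprM sqr_sqrtr//.
  by rewrite sqr_sqrtr//; lra.
have qlink n : `|deviation (q n.+1) w - deviation (q n) w| <=
    c * (2 * (Num.sqrt 2 ^+ (j0 + n) * delta (j0 + n) +
              Num.sqrt 2 ^+ (j0 + n.+1) * delta (j0 + n.+1))).
  have kn := (kxP (j0 + n)%N).1; have kn1 := (kxP (j0 + n).+1).1.
  have := not_pair_bad _ _ _ _ nL (link n _ _ kn kn1).
  rewrite /q addnS sqrt_tau => /le_trans; apply.
  set y := pt _.+1 _; set z := pt _ _.
  have -> : 8 * sigma * nrm (y - z) `^ alpha * (Num.sqrt (8 / N%:R) * Num.sqrt 2 ^+ (j0 + n)) =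
      c * (nrm (y - z) `^ alpha * Num.sqrt 2 ^+ (j0 + n)) by rewrite /c; ring.
  rewrite ler_wpM2l//.
  have yz : nrm (y - z) `^ alpha <= 2 * (delta (j0 + n)%N + delta (j0 + n).+1).
    apply: (@le_trans _ _ ((2 * Num.max (nrm (x - z)) (nrm (x - y))) `^ alpha)).
      apply: ge0_ler_powR; rewrite ?nnegrE ?(ltW alpha_gt0)//.
      - exact: is_norm_ge0.
      - by rewrite mulr_ge0// le_max is_norm_ge0.
      have [tri _ _] := nrm_norm.
      have := tri (y - x) (x - z); rewrite addrA subrK (is_normB _ nrm_norm y x).
      by move=> /le_trans; apply; rewrite mulr2n mulrDl mul1r addrC lerD// le_max lexx ?orbT.
    have m0 : 0 <= Num.max (nrm (x - z)) (nrm (x - y)) by rewrite le_max is_norm_ge0.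
    rewrite powRM//; apply: ler_pM; rewrite ?powR_ge0//.
      by apply: ler1_powR => //; lra.
    have h1 := (kxP (j0 + n)%N).2; have h2 := (kxP (j0 + n).+1).2.
    have d1 := delta_ge0 (j0 + n); have d2 := delta_ge0 (j0 + n).+1.
    by rewrite /Num.max; case: ifP => _; [move: h2|move: h1]; rewrite -/y -/z; lra.
  have s0 : 0 <= Num.sqrt 2 ^+ (j0 + n) :> R by rewrite exprn_ge0 ?sqrtr_ge0.
  have s1 : 1 <= Num.sqrt 2 :> R by rewrite -[leLHS]sqrtr1 ler_sqrt; lra.
  have := ler_wpM2r s0 yz; move=> /le_trans; apply.
  have : Num.sqrt 2 ^+ (j0 + n) * delta (j0 + n).+1 <=
      Num.sqrt 2 ^+ (j0 + n).+1 * delta (j0 + n).+1.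
    by rewrite ler_wpM2r// exprS ler_peMl.
  by lra.
have qsum m : `|deviation (q m) w - deviation xs w| <=
    c * (Dl * Num.sqrt (2 * u)) + c * (2 * (
      \sum_(n < m) Num.sqrt 2 ^+ (j0 + n) * delta (j0 + n)%N +
      \sum_(n < m) Num.sqrt 2 ^+ (j0 + n.+1) * delta (j0 + n.+1)%N)).
  elim: m => [|m IH]; first by rewrite !big_ord0 addr0 mulr0 mulr0 addr0.
  rewrite !big_ord_recr/=.
  have -> : deviation (q m.+1) w - deviation xs w =
    (deviation (q m.+1) w - deviation (q m) w) + (deviation (q m) w - deviation xs w) by ring.
  apply: (le_trans (ler_normD _ _)); have := qlink m; move: IH; lra.
have sum_shift m : \sum_(n < m) Num.sqrt 2 ^+ (j0 + n) * delta (j0 + n)%N <= G.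
  apply: le_trans (delta_sum (j0 + m)); rewrite big_split_ord/= lerDr.
  by apply: sumr_ge0 => n _; rewrite mulr_ge0 ?exprn_ge0 ?sqrtr_ge0.
have sum_shift1 m : \sum_(n < m) Num.sqrt 2 ^+ (j0 + n.+1) * delta (j0 + n.+1)%N <= G.
  apply: le_trans (sum_shift m.+1); rewrite big_ord_recl/= lerDr.
  by rewrite mulr_ge0 ?exprn_ge0 ?sqrtr_ge0.
have deltaG j : delta j <= G / Num.sqrt 2 ^+ j.
  have s0 : 0 < Num.sqrt 2 ^+ j :> R by rewrite exprn_gt0 ?sqrtr_gt0.
  rewrite ler_pdivlMr// mulrC; apply: le_trans (delta_sum j.+1).
  rewrite big_ord_recr/= lerDr; apply: sumr_ge0 => n _.
  by rewrite mulr_ge0 ?exprn_ge0 ?sqrtr_ge0.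
pose K := emp_mean xi (fun s => `|L s|) w + sigma.
have K0 : 0 <= K.
  rewrite addr_ge0 ?(ltW sigma_gt0)// /emp_mean mulr_ge0 ?invr_ge0//.
  exact: sumr_ge0.
(* The last jump from [q m] to [x] is not covered by any event. For fixed [w] it is bounded by the
   finite number [K] times [delta (j0 + m)], which decays like 2^(-m/2) by [deltaG]. *)
have total m : `|deviation x w - deviation xs w| <=
    c * (Dl * Num.sqrt (2 * u) + 4 * G) + K * G / Num.sqrt 2 ^+ j0 * (Num.sqrt 2)^-1 ^+ m.
  have -> : deviation x w - deviation xs w =
    (deviation x w - deviation (q m) w) + (deviation (q m) w - deviation xs w) by ring.
  apply: (le_trans (ler_normD _ _)).
  have h1 : `|deviation x w - deviation (q m) w| <= K * (G / Num.sqrt 2 ^+ (j0 + m)).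
    apply: (le_trans (deviation_holder x (q m) w Vx (ptV _ _))).
    rewrite -/K ler_wpM2l//; apply: le_trans (deltaG _); exact: (kxP _).2.
  have h2 := qsum m.
  have h3 : c * (2 * (\sum_(n < m) Num.sqrt 2 ^+ (j0 + n) * delta (j0 + n)%N +
      \sum_(n < m) Num.sqrt 2 ^+ (j0 + n.+1) * delta (j0 + n.+1)%N)) <= c * (4 * G).
    by rewrite ler_wpM2l//; have := sum_shift m; have := sum_shift1 m; lra.
  have -> : K * G / Num.sqrt 2 ^+ j0 * (Num.sqrt 2)^-1 ^+ m = K * (G / Num.sqrt 2 ^+ (j0 + m)).
    by rewrite exprD invfM exprVn; ring.
  by move: h1 h2 h3; lra.
have s1 : `|(Num.sqrt 2)^-1| < 1 :> R.
  rewrite ger0_norm ?invr_ge0 ?sqrtr_ge0// invf_lt1 ?sqrtr_gt0//.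
  by rewrite -[ltLHS]sqrtr1 ltr_sqrt//; lra.
have lim : (c * (Dl * Num.sqrt (2 * u) + 4 * G) +
    K * G / Num.sqrt 2 ^+ j0 * (Num.sqrt 2)^-1 ^+ m) @[m --> \oo] -->
    c * (Dl * Num.sqrt (2 * u) + 4 * G) + K * G / Num.sqrt 2 ^+ j0 * 0.
  by apply: cvgD; [exact: cvg_cst|apply: cvgMl_tmp; exact: cvg_expr].
rewrite mulr0 addr0 in lim.
by apply: (cvgr_to_ge lim); exact: nearW.
Qed.

End Chaining.

(** Chaining controls deviations relative to [xs], and a tail bound at [xs] supplies the base value.
    The bad event collects exp (-u) from chaining, 2 exp (-u) from the two-sided tail at [xs], and
    rho from each of the two goodness assumptions. *)
Lemma index_event {R : realType} {dXi dOmega : measure_display}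
    {Xi : measurableType dXi} {Omega : measurableType dOmega}
    {P : probability Xi R} {PP : probability Omega R} {N : nat}
    (xi : 'I_N -> Omega -> Xi) (d : nat) (nrm : 'rV[R]_d -> R)
    (alpha sigma sigmastar rho : R) (H : 'rV[R]_d -> Xi -> R) (L : Xi -> R)
    (V : set 'rV[R]_d) (xs : 'rV[R]_d) (pt : nat -> nat -> 'rV[R]_d)
    (delta : nat -> R) (G Dl u : R) :
  iid_sample P PP xi -> (0 < N)%N -> is_norm nrm -> 0 < alpha -> alpha <= 1 ->
  0 < sigma -> 0 < sigmastar ->
  (forall x, V x -> measurable_fun setT (H x)) ->
  (forall x, V x -> P.-integrable setT (EFin \o H x)) ->
  (forall x y s, V x -> V y -> `|H x s - H y s| <= L s * nrm (x - y) `^ alpha) ->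
  good P PP xi rho (sigma ^+ 2) (fun s => L s ^+ 2) ->
  good P PP xi rho (sigmastar ^+ 2) (fun s => (H xs s - \int[P]_s H xs s) ^+ 2) ->
  V xs -> (forall j k, V (pt j k)) -> (forall j, 0 <= delta j) ->
  (forall j x, V x ->
    exists2 k, (k < 2 ^ (2 ^ j))%N & nrm (x - pt j k) `^ alpha <= delta j) ->
  (forall n, \sum_(j < n) Num.sqrt 2 ^+ j * delta j <= G) ->
  (forall x y, V x -> V y -> nrm (x - y) `^ alpha <= Dl) -> 1 <= u ->
  exists Bad : set Omega,
  [/\ measurable Bad, (PP Bad <= (2 * rho + 3 * expR (- u))%:E)%E &
   forall w, ~ Bad w -> forall x, V x ->
     `|emp_mean xi (H x) w - \int[P]_s H x s| <= 4 * sigmastar * Num.sqrt (u / N%:R) +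
       8 * sigma * Num.sqrt (8 / N%:R) * (Dl * Num.sqrt (2 * u) + 4 * G)].
Proof.
move=> iid N_gt0 nrm_norm a0 a1 s0 ss0 mH iH hH [_ mL2 EL2 gL] [_ mX2 EX2 gX]
  Vxs ptV d0 net dsum Vdiam u1.
have N0 : 0 < N%:R :> R by rewrite ltr0n.
have L2le : (\int[P]_s (L s ^+ 2)%:E <= (sigma ^+ 2)%:E)%E by rewrite unlock in EL2.
have [B1 [mB1 pB1 hB1]] := chaining_bound xi iid N_gt0 d nrm alpha sigma H L V
  nrm_norm a0 a1 s0 mH iH hH mL2 L2le xs pt delta G Dl u Vxs ptV d0 net dsum Vdiam u1.
set m := \int[P]_s H xs s in mX2 EX2 gX.
pose X s := H xs s - m.
have im : P.-integrable setT (EFin \o cst m) by exact: finite_measure_integrable_cst.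
have iX : P.-integrable setT (EFin \o X).
  apply: (eq_integrable measurableT (fun s => (EFin \o H xs) s - (EFin \o cst m) s)%E) => //.
  by apply: integrableB => //; exact: iH.
have X0 : (\int[P]_s (X s)%:E = 0)%E.
  under eq_integral do rewrite EFinB.
  rewrite (integralB _ (iH _ Vxs) im)//.
  have -> : (\int[P]_x (EFin \o cst m) x = m%:E)%E.
    apply: (etrans (integral_cst P measurableT m%:E)).
    by rewrite -[RHS]mule1; congr (_ * _)%E; exact: probability_setT.
  by rewrite /m /Rintegral fineK ?subee//; apply: integrable_fin_num => //; exact: iH.
have mX : measurable_fun setT X by apply/measurable_EFinP; exact: measurable_int iX.
have X2 : (\int[P]_s (X s ^+ 2)%:E <= (sigmastar ^+ 2)%:E)%E by rewrite unlock in EX2.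
have v0 : 0 < sigmastar ^+ 2 by exact: exprn_gt0.
have u0 : 0 <= u by lra.
have b0 : 0 <= 2 :> R by [].
have tail := self_normalized_tail2 xi iid X _ 2 u iX X0 X2 N_gt0 v0 u0 b0.
set B2 := (X in PP X) in tail.
have mB2 : measurable B2.
  apply: measurableD.
    apply: measurable_superlevel; apply: measurableT_comp => //.
    exact: (measurable_sample_sum xi iid X mX).
  exact: (measurable_sum_superlevel xi iid (fun s => X s ^+ 2)).
pose B3 := [set w | 2 * sigma ^+ 2 < emp_mean xi (fun s => L s ^+ 2) w].
pose B4 := [set w | 2 * sigmastar ^+ 2 < emp_mean xi (fun s => X s ^+ 2) w].
have mB3 : measurable B3.
  by apply: measurable_superlevel; exact: (measurable_emp_mean xi iid _ mL2).
have mB4 : measurable B4.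
  by apply: measurable_superlevel; exact: (measurable_emp_mean xi iid _ mX2).
have m12 : measurable (B1 `|` B2) by exact: measurableU.
have m34 : measurable (B3 `|` B4) by exact: measurableU.
exists ((B1 `|` B2) `|` (B3 `|` B4)); split; first exact: measurableU.
  apply: (le_trans (measureU2 PP m12 m34)).
  apply: (le_trans (leeD (measureU2 PP mB1 mB2) (measureU2 PP mB3 mB4))).
  apply: (le_trans (leeD (leeD pB1 tail) (leeD gL gX))).
  by rewrite -!EFinD lee_fin; lra.
move=> w /not_orP[/not_orP[nB1 nB2] /not_orP[nB3 nB4]] x Vx.
have h1 := hB1 w nB1 nB3 x Vx.
have sX : \sum_k X (xi k w) = N%:R * (emp_mean xi (H xs) w - m).
  rewrite /emp_mean mulrBr mulrA divff ?gt_eqF// mul1r /X sumrB sumr_const card_ord.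
  by rewrite mulr_natl.
have h2 : `|emp_mean xi (H xs) w - m| <= 4 * sigmastar * Num.sqrt (u / N%:R).
  rewrite leNgt; apply/negP => hlt; apply: nB2; split => /=.
    rewrite sX normrM (ger0_norm (ltW N0)).
    have -> : (2 + 2) * Num.sqrt (u * (N%:R * sigmastar ^+ 2)) =
        N%:R * (4 * sigmastar * Num.sqrt (u / N%:R)).
      have -> : u * (N%:R * sigmastar ^+ 2) = (sigmastar * N%:R) ^+ 2 * (u / N%:R).
        by field; rewrite gt_eqF.
      rewrite sqrtrM ?sqr_ge0// sqrtr_sqr ger0_norm; first by ring.
      by rewrite mulr_ge0 ?(ltW N0)// ltW.
    by rewrite ltr_pM2l.
  move=> hV; apply: nB4; rewrite /B4/= /emp_mean ltr_pdivlMl//.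
  by rewrite mulrCA.
have -> : emp_mean xi (H x) w - \int[P]_s H x s =
    (emp_mean xi (H xs) w - m) + ((emp_mean xi (H x) w - \int[P]_s H x s) -
    (emp_mean xi (H xs) w - m)) by ring.
by apply: (le_trans (ler_normD _ _)); apply: lerD.
Qed.

(** * The proposition *)

(** The requirement C phi <= 1 excludes an infinite chaining constant, so [fine] loses nothing. *)
Lemma sqrte_rate {R : realType} (Ca : \bar R) (b t C : R) (N : nat) :
  (0 < N)%N -> 0 < C -> (1 <= Ca)%E ->
  let phiE := sqrte ((Ca + (b + t)%:E) * (N%:R^-1)%:E)%E in
  (C%:E * phiE <= 1)%E ->
  exists ca : R, [/\ Ca = ca%:E, 1 <= ca,
    fine phiE = Num.sqrt ((ca + b + t) / N%:R) & C * fine phiE <= 1].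
Proof.
move=> N_gt0 C0 Ca1 phiE; rewrite /phiE; case: Ca Ca1 @phiE => [ca| |]//=.
  rewrite lee_fin => ca1; rewrite -EFinM lee_fin addrA => h.
  by exists ca; split => //; rewrite /= ?addrA.
move=> _; rewrite gt0_mulye ?lte_fin ?invr_gt0 ?ltr0n//= gt0_muley ?lte_fin//.
Qed.

Lemma chaining_ratio_le_const {R : realType} {d : nat} {I : finType}
    (nrm : 'rV[R]_d -> R) (Y : set 'rV[R]_d) (g : option I -> 'rV[R]_d -> R)
    (alpha theta : R) : 0 <= theta ->
  (chaining_ratio nrm alpha (near_opt Y g 0 theta) ^+ 2 <=
   chaining_const nrm Y g alpha theta)%E.
Proof.
move=> theta0; apply: ereal_sup_ubound; exists theta => //.
by rewrite /= in_itv/= theta0 lexx.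
Qed.

Lemma prob_ge_of_bad {R : realType} {d} {Omega : measurableType d}
    (PP : probability Omega R) (J : finType) (Bad : J -> set Omega)
    (E : set Omega) (q r : R) :
  (forall j, measurable (Bad j)) -> (forall j, (PP (Bad j) <= q%:E)%E) ->
  (forall w, (forall j, ~ Bad j w) -> E w) -> r <= 1 - #|J|%:R * q ->
  prob_ge PP E r.
Proof.
move=> mB Bq BE rq; pose U := \big[setU/set0]_j Bad j.
have mU : measurable U by exact: bigsetU_measurable.
exists (~` U); split; first exact: measurableC.
  by move=> w nU; apply: BE => j Bj; apply: nU; rewrite /U (bigD1 j)//=; left.
rewrite probability_setC//.
have Uq : (PP U <= (#|J|%:R * q)%:E)%E.
  apply: (le_trans (measure_bigsetU_le PP _ _ _ mB)).
  apply: (@le_trans _ _ (\sum_(j : J) q%:E)%E); first by apply: lee_sum => j _; exact: Bq.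
  by rewrite sumEFin sumr_const mulr_natl.
apply: (@le_trans _ _ (1%:E - (#|J|%:R * q)%:E)%E); first by rewrite -EFinB lee_fin.
by apply: leeB.
Qed.

(** * Pulling the tube back to the feasible set *)

Section Tube.
Context {R : realType} {d : nat} {I : finType} (nrm : 'rV[R]_d -> R).
Variables (Y : set 'rV[R]_d) (f : option I -> 'rV[R]_d -> R).
Variables (xstar xbar : 'rV[R]_d) (eta theta : R).
Hypothesis nrm_norm : is_norm nrm.
Hypothesis convexY : convex_set Y.
Hypothesis convexf : forall i, convex_function Y (f i).
Hypotheses (eta_gt0 : 0 < eta) (theta_gt0 : 0 < theta).
Hypothesis xstarP : minimizer Y f xstar.
Hypothesis xbarP : near_opt Y f (- eta) theta xbar.

Let pull (x : 'rV[R]_d) :=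
  (1 / 2) *: ((1 / 2) *: xbar + (1 - 1 / 2) *: xstar) + (1 - 1 / 2) *: x.

Lemma pull_near_opt x : near_opt Y f (eta / 2) theta x -> near_opt Y f 0 theta (pull x).
Proof.
have h01 : 0 <= (1 / 2 : R) <= 1 by lra.
have eta0 := eta_gt0; have theta0 := theta_gt0.
move=> [[Yx fx] ox]; have [[Yb fb] ob] := xbarP; have [[Ys fs] _] := xstarP.
have os : f None xstar = optval Y f by rewrite (minimizer_optval _ _ _ xstarP).
have Ym : Y ((1 / 2) *: xbar + (1 - 1 / 2) *: xstar) by exact: convex_set_segment.
have fm i := convex_function_segment _ _ _ xbar xstar _ (convexf i) h01 Yb Ys.
have fp i := convex_function_segment _ _ _ _ x _ (convexf i) h01 Ym Yx.
split; first split; first exact: convex_set_segment.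
  move=> i; apply: (le_trans (fp (Some i))).
  have := fm (Some i); have := fx i; have := fb i; have := fs i; lra.
apply: (le_trans (fp None)); have := fm None; rewrite os; move: ob ox; lra.
Qed.

Lemma pull_nrm x y : nrm (x - y) <= 2 * nrm (pull x - pull y).
Proof.
have [_ hom _] := nrm_norm.
have -> : pull x - pull y = (1 / 2) *: (x - y).
  by apply/rowP => i; rewrite !mxE; field.
by rewrite hom ger0_norm; lra.
Qed.

End Tube.

Definition dev_const {R : realType} (alpha sigma sigmastar D : R) : R :=
  8 * sigmastar + 8 * sigma * (8 * (2 * D) `^ alpha + 48 * D `^ alpha).

Lemma dev_const_gt0 {R : realType} (alpha sigma sigmastar D : R) :
  0 < sigma -> 0 < sigmastar -> 0 < D -> 0 < dev_const alpha sigma sigmastar D.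
Proof.
move=> s0 ss0 D0; rewrite /dev_const addr_gt0 ?mulr_gt0//.
by rewrite addr_gt0 ?mulr_gt0 ?powR_gt0 ?mulr_gt0.
Qed.

Lemma dev_bound_le {R : realType} (alpha sigma sigmastar D D0 r u ca N : R) :
  0 < alpha <= 1 -> 0 < sigma -> 0 < sigmastar -> 0 <= D0 <= D -> 0 < N ->
  0 <= r -> r ^+ 2 <= ca -> 0 <= u <= 3 * ca ->
  4 * sigmastar * Num.sqrt (u / N) +
    8 * sigma * Num.sqrt (8 / N) * ((2 * D) `^ alpha * Num.sqrt (2 * u) +
      4 * (2 `^ alpha * (2 * r * D0 `^ alpha))) <=
  dev_const alpha sigma sigmastar D * Num.sqrt (ca / N).
Proof.
move=> /andP[a0 a1] s0 ss0 /andP[D00 D0D] N0 r0 rca /andP[u0 uca].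
have ca0 : 0 <= ca by apply: le_trans rca; exact: sqr_ge0.
set phi := Num.sqrt (ca / N); have phi0 : 0 <= phi by exact: sqrtr_ge0.
have sqle (x y : R) : 0 <= x -> 0 <= y -> x <= y ^+ 2 * (ca / N) -> Num.sqrt x <= y * phi.
  move=> x0 y0 xy; rewrite -[y]ger0_norm// -sqrtr_sqr -sqrtrM ?sqr_ge0//.
  by rewrite ler_wsqrtr.
have caN : 0 <= ca / N by rewrite divr_ge0// ltW.
have h1 : Num.sqrt (u / N) <= 2 * phi.
  apply: sqle => //; first by rewrite divr_ge0// ltW.
  by rewrite mulrA ler_wpM2r ?invr_ge0 ?(ltW N0)//; lra.
have h2 : Num.sqrt (8 / N) * Num.sqrt (2 * u) <= 8 * phi.
  rewrite -sqrtrM ?divr_ge0 ?(ltW N0)//; apply: sqle => //.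
    by rewrite mulr_ge0 ?divr_ge0 ?(ltW N0) ?mulr_ge0.
  rewrite mulrA mulrAC ler_wpM2r ?invr_ge0 ?(ltW N0)//; lra.
have h3 : Num.sqrt (8 / N) * r <= 3 * phi.
  rewrite -[r]ger0_norm// -sqrtr_sqr -sqrtrM ?divr_ge0 ?(ltW N0)//; apply: sqle => //.
    by rewrite mulr_ge0 ?sqr_ge0// divr_ge0// ltW.
  rewrite mulrA mulrAC ler_wpM2r ?invr_ge0 ?(ltW N0)//; lra.
have p2 : 2 `^ alpha <= 2 :> R by apply: ler1_powR => //; lra.
have pD : D0 `^ alpha <= D `^ alpha.
  by apply: ge0_ler_powR; rewrite ?nnegrE ?(ltW a0)//; lra.
have h4 : 4 * sigmastar * Num.sqrt (u / N) <= 8 * sigmastar * phi.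
  have := ler_wpM2l (ltW ss0) h1; lra.
have A0 : 0 <= (2 * D) `^ alpha by exact: powR_ge0.
have B0 : 0 <= D0 `^ alpha by exact: powR_ge0.
have h5 : Num.sqrt (8 / N) * ((2 * D) `^ alpha * Num.sqrt (2 * u)) <= 8 * (2 * D) `^ alpha * phi.
  have := ler_wpM2l A0 h2; lra.
have h6 : Num.sqrt (8 / N) * (4 * (2 `^ alpha * (2 * r * D0 `^ alpha))) <= 48 * D `^ alpha * phi.
  have -> : Num.sqrt (8 / N) * (4 * (2 `^ alpha * (2 * r * D0 `^ alpha))) =
    8 * (2 `^ alpha * D0 `^ alpha) * (Num.sqrt (8 / N) * r) by ring.
  have -> : 48 * D `^ alpha * phi = 8 * (2 * D `^ alpha) * (3 * phi) by ring.
  apply: ler_pM => //; rewrite ?mulr_ge0 ?powR_ge0 ?sqrtr_ge0//.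
  by rewrite ler_wpM2l//; apply: ler_pM; rewrite ?powR_ge0.
have s8 : 0 <= 8 * sigma by rewrite mulr_ge0// ltW.
have := ler_wpM2l s8 (lerD h5 h6); rewrite /dev_const; lra.
Qed.

(** k + 1 <= 2 k and 6 <= 8 <= exp 3: the shift by 3 absorbs the three tails and the additional
    objective index. *)
Lemma failure_le {R : realType} (k : nat) (t : R) : (0 < k)%N ->
  3 * expR (- (t + ln k%:R + 3)) * k.+1%:R <= expR (- t).
Proof.
move=> k0; have k0' : 0 < k%:R :> R by rewrite ltr0n.
have k1 : 1 <= k%:R :> R by rewrite ler1n.
have -> : - (t + ln k%:R + 3) = - t - ln k%:R - 3%:R * 1 by ring.
rewrite !expRB lnK ?posrE// expRM_natl.
have e8 : 2 ^+ 3 <= expR 1 ^+ 3 :> R.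
  by rewrite lerXn2r ?nnegrE ?expR_ge0//; exact: two_le_expR1.
have e0 : 0 < expR 1 ^+ 3 :> R by rewrite exprn_gt0// expR_gt0.
have -> : 3 * (expR (- t) / k%:R / expR 1 ^+ 3) * k.+1%:R =
   expR (- t) * ((3 * k.+1%:R) / (k%:R * expR 1 ^+ 3)) by field; rewrite !gt_eqF.
rewrite ger_pMr ?expR_gt0// ler_pdivrMr ?mulr_gt0// mul1r.
have := ler_wpM2l (ltW k0') e8; rewrite -natr1 !exprS expr0; lra.
Qed.

Lemma convex_function_saa {R : realType} {d : nat} {I : finType}
    {dXi dOmega : measure_display} {Xi : measurableType dXi}
    {Omega : measurableType dOmega} {N : nat} (xi : 'I_N -> Omega -> Xi)
    (Y : set 'rV[R]_d) (F : option I -> 'rV[R]_d -> Xi -> R) (w : Omega) i :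
  (forall s, convex_function Y (fun x => F i x s)) ->
  convex_function Y (saa_fun xi F w i).
Proof.
move=> cF a x y Yx Yy; rewrite convRE /saa_fun /emp_mean.
rewrite !(mulrCA _ N%:R^-1) -mulrDr ler_wpM2l ?invr_ge0//.
rewrite !mulr_sumr -big_split/=; apply: ler_sum => k _.
by have := cF (xi k w) a x y Yx Yy; rewrite convRE.
Qed.

Lemma greatness_goodness {R : realType} {d : nat} {I : finType}
    {dXi dOmega : measure_display} {Xi : measurableType dXi}
    {Omega : measurableType dOmega} (P : probability Xi R) (PP : probability Omega R)
    {N : nat} (xi : 'I_N -> Omega -> Xi) (nrm : 'rV[R]_d -> R) (Y Z : set 'rV[R]_d)
    (F : option I -> 'rV[R]_d -> Xi -> R) (xstar : 'rV[R]_d)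
    (s2star s2 alpha p kappa : R) :
  iid_sample P PP xi -> (0 < N)%N -> Z `<=` Y -> Z xstar ->
  greatness P nrm Y F xstar Y s2star s2 alpha p kappa ->
  goodness P PP xi nrm Y F xstar Z s2star s2 alpha
    ((4 * expR 1 * kappa * Num.sqrt (p / N%:R)) `^ p).
Proof.
move=> iid N_gt0 ZY Zx [p2 k1 [[_ _ ss0 s0 a01] cF Fx FL]]; split.
  by rewrite powR_gt0// !mulr_gt0 ?expR_gt0 ?sqrtr_gt0 ?divr_gt0 ?ltr0n//; lra.
split => // i.
  exact: (great_good xi iid N_gt0 _ p kappa s2star p2 k1 ss0 (Fx i)).
have [L [gL hL]] := FL i; exists L; split.
  exact: (great_good xi iid N_gt0 _ p kappa s2 p2 k1 s0 gL).
by move=> x x' s Zx1 Zx2; apply: hL; exact: ZY.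
Qed.

Theorem proposition4 (R : realType) :
  exists c_bdg : R, 0 < c_bdg /\
  forall eta theta sigma sigmastar alpha kappa c diamXstar : R,
  0 < eta -> 0 < theta -> 0 < sigma -> 0 < sigmastar ->
  0 < alpha <= 1 -> 0 < kappa <= 1 -> 0 < alpha * kappa < 1 -> 0 < c ->
  exists C : R, 1 < C /\
  forall (d : nat) (nrm : 'rV[R]_d -> R) (I : finType)
    (dXi : measure_display) (Xi : measurableType dXi) (P : probability Xi R)
    (dOmega : measure_display) (Omega : measurableType dOmega)
    (PP : probability Omega R)
    (N : nat) (xi : 'I_N -> Omega -> Xi)
    (Y : set 'rV[R]_d) (F : option I -> 'rV[R]_d -> Xi -> R)
    (xstar : 'rV[R]_d) (t eps0 : R),
  let f := mean_fun P F in
  let phiE := phi_rate I (chaining_const nrm Y f alpha theta) t N in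
  let phi := fine phiE in
  let RN := R_rate C alpha eps0 phi in
  let DN := D_rate C alpha kappa eps0 phi in
  let Good := good_event nrm Y f (saa_fun xi F) eta theta sigmastar eps0 t N
                RN DN in
  let conclusion := fun rho : R =>
    prob_ge PP Good (1 - expR (- t) - 2 * (#|I|%:R + 1) * rho) in
  is_norm nrm -> (0 < N)%N -> iid_sample P PP xi ->
  caratheodory P Y F ->
  minimizer Y f xstar ->
  (forall w : Omega, exists x, minimizer Y (saa_fun xi F w) x) ->
  (0 < #|I|)%N ->
  localized_slater nrm Y f eta theta ->
  (forall i s, convex_function Y (fun x => F i x s)) ->
  diam nrm (near_opt Y f 0 0) = diamXstar%:E ->
  (forall eps : R, 0 < eps <= theta ->
     (diam nrm (near_opt Y f 0 eps) <=
        (c * eps `^ kappa)%:E + diam nrm (near_opt Y f 0 0))%E) ->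
  0 < t -> 0 <= eps0 < Num.min (theta / 4) (1 / 2) ->
  (C%:E * phiE <= 1)%E ->
  (forall rho : R,
     goodness P PP xi nrm Y F xstar (near_opt Y f eta theta)
       (sigmastar ^+ 2) (sigma ^+ 2) alpha rho ->
     conclusion rho) /\
  (forall p kappap : R,
     greatness P nrm Y F xstar Y
       (sigmastar ^+ 2) (sigma ^+ 2) alpha p kappap ->
     conclusion ((c_bdg * kappap * Num.sqrt (p / N%:R)) `^ p)).
Proof.
exists (4 * expR 1); split; first by rewrite mulr_gt0 ?expR_gt0.
move=> eta theta sigma sigmastar alpha kappa c diamXstar eta0 theta0 s0 ss0 a01 _ _ c0.
(* [diamXstar] is quantified before it is known to be a diameter; the absolute value keeps [D]
   positive. *)
pose D := c * theta `^ kappa + `|diamXstar|.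
have D_gt0 : 0 < D by rewrite ltr_pwDl// mulr_gt0 ?powR_gt0.
pose K := dev_const alpha sigma sigmastar D.
have K0 : 0 < K by exact: dev_const_gt0.
have te0 : 0 < theta / eta by rewrite divr_gt0.
(* Each summand serves one demand on the deviation [K * phi]. Through C phi <= 1 the first two after
   the 2 give the smallness relative to [eta] and [theta]; the last two make [RN] and [DN] large
   enough. The 2 ensures [1 < C], hence [phi <= 1]. *)
pose C := 2 + (K * (4 / eta) + K * (2 + theta / eta) * (4 / theta) +
  2 * (K * (2 + theta / eta)) + K).
have Ke0 : 0 < K * (4 / eta) by rewrite mulr_gt0 ?divr_gt0.
have Kt : 0 < K * (2 + theta / eta) by rewrite mulr_gt0// addr_gt0.
have Kt0 : 0 < K * (2 + theta / eta) * (4 / theta) by rewrite mulr_gt0// divr_gt0.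
have C1 : 1 < C by rewrite /C; lra.
have C_gt0 : 0 < C by lra.
exists C; split => //.
move=> d nrm I dXi Xi P dOmega Omega PP N xi Y F xstar t eps0 f phiE phi RN DN Good
  conclusion nrm_norm N_gt0 iid [mF _ iF] xstarP saaP I_gt0 slater convF diamX diam_growth
  t0 eps0P CphiE.
have [[convY _] fY _ _ [xbar xbarP]] := slater.
have contf i : {within Y, continuous (f i)} by have [] := fY i.
have convf i : convex_function Y (f i) by have [] := fY i.
have /andP[a0 a1] := a01.
pose Z0 := near_opt Y f 0 theta; pose V := near_opt Y f (eta / 2) theta.
have xstar_near a b : 0 <= a -> 0 <= b -> near_opt Y f a b xstar.
  move=> a_ge0 b_ge0; have [[Ys fs] _] := xstarP; split.
    by split=> // i; exact: le_trans a_ge0.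
  by rewrite (minimizer_optval _ _ _ xstarP) lerDl.
have Vxs : V xstar by apply: xstar_near; rewrite ?divr_ge0// ltW.
suff core rho : goodness P PP xi nrm Y F xstar (near_opt Y f eta theta)
    (sigmastar ^+ 2) (sigma ^+ 2) alpha rho -> conclusion rho.
  split => [|p kappap gr]; first exact: core.
  apply: core; apply: (greatness_goodness P PP xi nrm Y) gr => //.
    by move=> x [[]].
  by apply: xstar_near; exact: ltW.
move=> [rho0 [[ZY _ _ _ _] _ Fx FL]].
have [D0 [D0E D00 D0D]] : exists D0, [/\ diam nrm Z0 = D0%:E, 0 <= D0 & D0 <= D].
  have th : 0 < theta <= theta by rewrite theta0 lexx.
  have := diam_growth theta th; rewrite diamX -EFinD => le.
  have fin : diam nrm Z0 \is a fin_num.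
    by rewrite ge0_fin_numE ?diam_ge0//; exact: le_lt_trans le (ltry _).
  exists (fine (diam nrm Z0)); rewrite fineK// fine_ge0 ?diam_ge0//; split => //.
  rewrite -lee_fin fineK//; apply: (le_trans le); rewrite lee_fin lerD2l.
  exact: ler_norm.
have Z0x : Z0 !=set0 by exists xstar; apply: xstar_near => //; exact: ltW.
have ratio1 := chaining_ratio_ge1 nrm alpha nrm_norm a0 Z0 D0 Z0x D0E.
have ratioC : (chaining_ratio nrm alpha Z0 ^+ 2 <= chaining_const nrm Y f alpha theta)%E.
  by apply: chaining_ratio_le_const; exact: ltW.
have Ca1 : (1 <= chaining_const nrm Y f alpha theta)%E.
  by apply: le_trans ratioC; rewrite expe2 -[leLHS]mule1; apply: lee_pmul.
have [ca [CaE ca1 phiEq Cphi]] := sqrte_rate _ (ln #|I|%:R) t C N N_gt0 C_gt0 Ca1 CphiE.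
rewrite CaE in ratioC.
have [r [ratioE r1 r2]] : exists r : R,
    [/\ chaining_ratio nrm alpha Z0 = r%:E, 1 <= r & r ^+ 2 <= ca].
  case: (chaining_ratio nrm alpha Z0) ratio1 ratioC => [r| |]//.
  by rewrite -EFin_expe !lee_fin => r1 r2; exists r.
have I1 : 1 <= #|I|%:R :> R by rewrite ler1n.
have lnI : 0 <= ln #|I|%:R :> R by exact: ln_ge0.
have N0 : 0 < N%:R :> R by rewrite ltr0n.
have phi_gt0 : 0 < phi by rewrite /phi [fine _]phiEq sqrtr_gt0 divr_gt0//; lra.
have phi1 : phi <= 1.
  have : 1 * phi <= C * phi by rewrite ler_wpM2r ?(ltW phi_gt0)// ltW.
  by move: Cphi; rewrite -/phi; lra.
pose u := t + ln #|I|%:R + 3.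
have u1 : 1 <= u by rewrite /u; lra.
have [pt [delta [ptV delta0 net dsum]]] :=
  chaining_nets nrm alpha nrm_norm a0 Z0 V _ xstar D0 r Vxs
    (pull_near_opt Y f xstar xbar eta theta convY convf eta0 theta0 xstarP xbarP)
    (fun x y _ _ => pull_nrm nrm xstar xbar nrm_norm x y) D0E
    (eq_ind_r (fun z => (z <= r%:E)%E) (lexx _) ratioE).
have Vdiam x y : V x -> V y -> nrm (x - y) `^ alpha <= (2 * D) `^ alpha.
  move=> Vx Vy; apply: ge0_ler_powR; rewrite ?nnegrE ?is_norm_ge0 ?mulr_ge0 ?(ltW a0) ?(ltW D_gt0)//.
  apply: (le_trans (pull_nrm nrm xstar xbar nrm_norm x y)); rewrite ler_wpM2l//.
  apply: le_trans D0D; rewrite -lee_fin -D0E; apply: diam_ge;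
    exact: (pull_near_opt Y f xstar xbar eta theta).
have VZ : V `<=` near_opt Y f eta theta by apply: near_optS => //; lra.
have VY x : V x -> Y x by move=> [[]].
have badP i : exists Bad : set Omega,
    [/\ measurable Bad, (PP Bad <= (2 * rho + 3 * expR (- u))%:E)%E &
     forall w, ~ Bad w -> forall x, V x -> `|saa_fun xi F w i x - f i x| <= K * phi].
  have [L [gL hL]] := FL i.
  have [Bad [mBad pBad hBad]] := index_event xi d nrm alpha sigma sigmastar rho (F i) L V xstar
    pt delta _ _ u iid N_gt0 nrm_norm a0 a1 s0 ss0 (fun x Vx => mF i x (VY x Vx))
    (fun x Vx => iF i x (VY x Vx)) (fun x y s Vx Vy => hL x y s (VZ x Vx) (VZ y Vy))
    gL (Fx i) Vxs ptV delta0 net dsum Vdiam u1.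
  exists Bad; split => // w nB x Vx; apply: (le_trans (hBad w nB x Vx)).
  rewrite /phi [fine _]phiEq; apply: dev_bound_le => //.
  - by rewrite D00.
  - lra.
  - by apply: (le_trans r2); lra.
  - by rewrite /u; lra.
have [Bad BadP] := choice badP.
apply: (prob_ge_of_bad PP (option I) Bad _ (2 * rho + 3 * expR (- u))).
- by move=> i; have [] := BadP i.
- by move=> i; have [] := BadP i.
- move=> w nBad; have [xhat xhatP] := saaP w.
  have Kphi : 0 < K * phi by rewrite mulr_gt0.
  have phi_ge0 := ltW phi_gt0.
  have eps0P' : 0 <= eps0 < theta / 4.
    by move: eps0P; rewrite lt_min => /andP[-> /andP[-> _]].
  have pA := mulr_gt0 Ke0 phi_gt0; have pB := mulr_gt0 Kt0 phi_gt0.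
  have pE := mulr_gt0 Kt phi_gt0.
  have Cphi' : C * phi <= 1 by exact: Cphi.
  have CE : C * phi = 2 * phi + (K * (4 / eta) * phi +
      K * (2 + theta / eta) * (4 / theta) * phi +
      2 * (K * (2 + theta / eta) * phi) + K * phi) by rewrite /C; ring.
  (* The deviation is linear in phi, whereas [RN] is stated with the larger power phi^alpha. *)
  have phia : phi <= phi `^ alpha.
    by apply: ger1_powR; rewrite ?phi_gt0.
  apply: (good_event_of_deviation nrm Y f (saa_fun xi F w) xstar xbar xhat
    eta theta (K * phi) eps0) => //.
  + by move=> i; exact: convex_function_saa.
  + have -> : K * phi = K * (4 / eta) * phi * (eta / 4) by field; rewrite gt_eqF.
    by rewrite ger_pMl ?divr_gt0//; lra.
  + have -> : K * phi * (2 + theta / eta) =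
        K * (2 + theta / eta) * (4 / theta) * phi * (theta / 4).
      by field; rewrite !gt_eqF.
    by rewrite ger_pMl ?divr_gt0//; lra.
  + move=> i x Vx; have [_ _ h] := BadP i; exact: h.
  + exact: ltW.
  + have p2 : 0 <= C * phi *
        Num.max (eps0 `^ (alpha * kappa)) (phi `^ (alpha ^+ 2 * kappa)).
      by rewrite mulr_ge0 ?(ltW (mulr_gt0 C_gt0 phi_gt0))// le_max powR_ge0.
    by rewrite /DN /D_rate; lra.
  + by rewrite le_max lexx.
  + rewrite /RN /R_rate le_max; apply/orP; right.
    apply: (@le_trans _ _ (C * phi)); first lra.
    by rewrite ler_wpM2l// ltW.
- rewrite card_option; have := failure_le #|I| t I_gt0; rewrite -/u -natr1; lra.
Qed.
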